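(* Let $H$ be a separable Hilbert space, $2\le p<\infty$, and $T$ a bounded linear operator on $H$ (not assumed compact). The following are equivalent: (i) $T\in S_p$; (ii) there is a constant $C>0$ such that $\sum_{n=1}^\infty\|Te_n\|^p\le C$ for every orthonormal basis $\{e_n\}$ of $H$; (iii) there is a constant $C>0$ such that $\sum_{n=1}^\infty\|Tf_n\|^p\le C$ for every frame $\{f_n\}$ of $H$ with upper frame bound at most $1$.
   Context: A sequence $\{f_n\}$ in $H$ is a frame if there are constants $0<C_1\le C_2$ such that $C_1\|f\|^2\le\sum_n|\langle f,f_n\rangle|^2\le C_2\|f\|^2$ for all $f\in H$. The upper frame bound is the infimum of all admissible $C_2$. For a compact operator $T$, its singular values $\lambda_1\ge\lambda_2\ge\cdots$ are the positive eigenvalues of $(T^*T)^{1/2}$, repeated according to multiplicity. For $0<p<\infty$, $S_p$ is the set of compact $T$ with $\{\lambda_n\}\in\ell^p$, and $\|T\|_p=(\sum_n\lambda_n^p)^{1/p}$. *)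

(* Defs.v *)
From HB Require Import structures.
From mathcomp Require Import all_boot all_order all_algebra.
From mathcomp Require Import all_classical all_reals all_analysis.
From mathcomp Require Export complex.
Set Implicit Arguments. Unset Strict Implicit. Unset Printing Implicit Defensive.
Import Order.TTheory GRing.Theory Num.Theory numFieldNormedType.Exports.
Local Open Scope classical_set_scope.
Local Open Scope ring_scope.

Section Hilbert.
Variables (R : realType) (H : lmodType R[i]) (ip : H -> H -> R[i]).

Definition inner_product_axioms : Prop :=
  [/\ forall (a : R[i]) (x y z : H), ip (a *: x + y) z = a * ip x z + ip y z,
      forall x y : H, ip y x = conjc (ip x y),
      forall x : H, complex.Im (ip x x) = 0 /\ 0 <= complex.Re (ip x x)
    & forall x : H, ip x x = 0 -> x = 0].

Definition hnorm (x : H) : R := Num.sqrt (complex.Re (ip x x)).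

Definition hcauchy (u : nat -> H) : Prop :=
  forall eps : R, 0 < eps -> exists N : nat,
    forall m n : nat, (N <= m)%N -> (N <= n)%N -> hnorm (u m - u n) < eps.

Definition hconverges_to (u : nat -> H) (l : H) : Prop :=
  hnorm (u n - l) @[n --> \oo] --> 0.

Definition separable_hilbert : Prop :=
  [/\ inner_product_axioms,
      (forall u : nat -> H, hcauchy u -> exists l, hconverges_to u l)
    & exists d : nat -> H, forall (x : H) (eps : R), 0 < eps ->
        exists n, hnorm (x - d n) < eps].

Definition bounded_linear (T : H -> H) : Prop :=
  linear T /\ exists M : R, forall x : H, hnorm (T x) <= M * hnorm x.

Definition compact_op (T : H -> H) : Prop :=
  forall u : nat -> H, (exists M : R, forall n, hnorm (u n) <= M) ->
    exists phi : nat -> nat, (forall n, (phi n < phi n.+1)%N) /\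
      exists l : H, hconverges_to (fun n => T (u (phi n))) l.

Definition is_adjoint (T Tstar : H -> H) : Prop :=
  forall x y : H, ip (T x) y = ip x (Tstar y).

Definition is_pos_sqrt (A S : H -> H) : Prop :=
  [/\ linear S, is_adjoint S S,
      forall x : H, complex.Im (ip (S x) x) = 0 /\ 0 <= complex.Re (ip (S x) x)
    & forall x : H, S (S x) = A x].

(* lam (restricted to indices with lam n > 0) is the list of the positive
   eigenvalues of S repeated according to multiplicity, witnessed by
   orthonormal eigenvectors e: for each mu > 0, the e n with lam n = mu form
   an orthonormal basis of ker (S - mu). *)
Definition pos_eigen_mult (S : H -> H) (lam : nat -> R) (e : nat -> H) : Prop :=
  [/\ forall n, 0 < lam n -> S (e n) = ((lam n)%:C)%C *: e n,
      forall n m, 0 < lam n -> 0 < lam m ->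
        ip (e n) (e m) = (if n == m then 1 else 0)
    & forall (mu : R) (x : H), 0 < mu -> S x = (mu%:C)%C *: x ->
        exists N : nat, x = \sum_(n < N | lam n == mu) ip x (e n) *: e n].

Definition schatten (p : R) (T : H -> H) : Prop :=
  compact_op T /\
  exists (Tstar S : H -> H) (lam : nat -> R) (e : nat -> H),
    [/\ is_adjoint T Tstar, is_pos_sqrt (fun x => Tstar (T x)) S,
        pos_eigen_mult S lam e
      & (\esum_(n in [set n | (0 < lam n)%R]) ((lam n) `^ p)%R%:E < +oo)%E].

Definition orthonormal_basis (I : countType) (e : I -> H) : Prop :=
  (forall i j : I, ip (e i) (e j) = (if i == j then 1 else 0)) /\
  (forall x : H, (forall i, ip x (e i) = 0) -> x = 0).

Definition frame_sum (I : countType) (f : I -> H) (x : H) : \bar R :=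
  (\esum_(i in [set: I]) ((ComplexField.Normc.normc (ip x (f i))) ^+ 2)%:E)%E.

Definition admissible_upper_bound (I : countType) (f : I -> H) (C2 : R) : Prop :=
  exists C1 : R, [/\ 0 < C1, C1 <= C2 &
    forall x : H, ((C1 * hnorm x ^+ 2)%:E <= frame_sum f x)%E /\
                  (frame_sum f x <= (C2 * hnorm x ^+ 2)%:E)%E].

Definition is_frame (I : countType) (f : I -> H) : Prop :=
  exists C2 : R, admissible_upper_bound f C2.

Definition upper_frame_bound (I : countType) (f : I -> H) : R :=
  inf [set C2 | admissible_upper_bound f C2].

End Hilbert.

(* Main.v *)
Require Import Defs.
From HB Require Import structures.
From mathcomp Require Import all_boot all_order all_algebra.
From mathcomp Require Import all_classical all_reals all_analysis.
From mathcomp Require Import complex.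
From mathcomp Require Import ring lra.
From mathcomp Require finmap.
Import Order.TTheory GRing.Theory Num.Theory numFieldNormedType.Exports.
Local Open Scope classical_set_scope.
Local Open Scope ring_scope.
Set Implicit Arguments. Unset Strict Implicit. Unset Printing Implicit Defensive.

(** If [T] is in [S_p], then [|T|] is diagonal with eigenvalues [lam n] in an
    orthonormal system [e n] whose orthogonal complement lies in [ker T], so
    [||T f||^2 = \sum_n lam n ^ 2 * |<f, e n>|^2].  For a Bessel family [f_k]
    with bound 1 the weights [|<f_k, e n>|^2] sum to at most 1 both over [n]
    and over [k]; as [p / 2 >= 1], Jensen's inequality gives
    [\sum_k ||T f_k||^p <= \sum_n lam n ^ p].  Orthonormal bases and frames with
    upper bound at most 1 are such families.

    Conversely, a uniform bound over orthonormal bases bounds the length of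
    orthonormal lists on which [||T x|| >= eps]; on the complement of a maximal
    such list [T] is at most [eps], hence [T] is compact.  A maximal orthonormal
    set of eigenvectors of [T^* T] then diagonalises [|T|], and since its
    eigenvalues are [||T (e n)||], extending the set to a basis bounds their
    [p]-th powers.  Finally, by Parseval, bases are frames with bound 1. *)

Local Notation nc := ComplexField.Normc.normc.

(** * Modulus of complex numbers *)

Section ComplexModulus.
Context {R : realType}.
Implicit Types (z w : R[i]) (r : R).

Lemma nc_ge0 z : 0 <= nc z.
Proof. by case: z => a b /=; rewrite sqrtr_ge0. Qed.

Lemma nc_sqr z : nc z ^+ 2 = complex.Re z ^+ 2 + complex.Im z ^+ 2.
Proof. by case: z => a b /=; rewrite sqr_sqrtr // addr_ge0 ?sqr_ge0. Qed.

Lemma mulc_conj z : z * conjc z = ((nc z ^+ 2)%:C)%C.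
Proof.
by rewrite nc_sqr; case: z => a b /=; apply/eqP; rewrite eq_complex /=;
  apply/andP; split; apply/eqP; ring.
Qed.

Lemma nc_conj z : nc (conjc z) = nc z.
Proof. by case: z => a b /=; rewrite sqrrN. Qed.

Lemma nc_real r : nc (r%:C)%C = `|r|.
Proof. by rewrite /= expr0n addr0 sqrtr_sqr. Qed.

Lemma nc_sub z w : nc (z - w) = nc (w - z).
Proof. by rewrite -normcN opprB. Qed.

Lemma Re_le_nc z : `|complex.Re z| <= nc z.
Proof.
rewrite -[nc z]ger0_norm ?nc_ge0// -ler_sqr ?nnegrE// !real_normK ?num_real//.
by rewrite nc_sqr lerDl sqr_ge0.
Qed.

Lemma Im_le_nc z : `|complex.Im z| <= nc z.
Proof.
rewrite -[nc z]ger0_norm ?nc_ge0// -ler_sqr ?nnegrE// !real_normK ?num_real//.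
by rewrite nc_sqr lerDr sqr_ge0.
Qed.

Lemma nc_le_ReIm z : nc z <= `|complex.Re z| + `|complex.Im z|.
Proof.
rewrite -ler_sqr ?nnegrE ?nc_ge0 ?addr_ge0// nc_sqr sqrrD !real_normK ?num_real//.
have := mulr_ge0 (normr_ge0 (complex.Re z)) (normr_ge0 (complex.Im z)); lra.
Qed.

End ComplexModulus.

(** * Inner products, norms and limits *)

Section InnerProduct.
Variables (R : realType) (H : lmodType R[i]) (ip : H -> H -> R[i]).
Hypothesis hip : inner_product_axioms ip.
Implicit Types (x y z : H) (a : R[i]).
Local Notation N := (hnorm ip).

Lemma ip_lin a x y z : ip (a *: x + y) z = a * ip x z + ip y z.
Proof. by case: hip. Qed.

Lemma ipC x y : ip y x = conjc (ip x y).
Proof. by case: hip. Qed.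

Lemma ipDl x y z : ip (x + y) z = ip x z + ip y z.
Proof. by have := ip_lin 1 x y z; rewrite scale1r mul1r. Qed.

Lemma ip0l z : ip 0 z = 0.
Proof. by apply: (addrI (ip 0 z)); rewrite -ipDl !addr0. Qed.

Lemma ipZl a x z : ip (a *: x) z = a * ip x z.
Proof. by have := ip_lin a x 0 z; rewrite addr0 ip0l addr0. Qed.

Lemma ipNl x z : ip (- x) z = - ip x z.
Proof. by rewrite -scaleN1r ipZl mulN1r. Qed.

Lemma ipBl x y z : ip (x - y) z = ip x z - ip y z.
Proof. by rewrite ipDl ipNl. Qed.

Lemma ipDr x y z : ip z (x + y) = ip z x + ip z y.
Proof. by rewrite ipC ipDl rmorphD /= -!ipC. Qed.

Lemma ip0r z : ip z 0 = 0.
Proof. by rewrite ipC ip0l conjc0. Qed.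

Lemma ipZr a x z : ip z (a *: x) = conjc a * ip z x.
Proof. by rewrite ipC ipZl rmorphM /= -ipC. Qed.

Lemma ipNr x z : ip z (- x) = - ip z x.
Proof. by rewrite ipC ipNl rmorphN /= -ipC. Qed.

Lemma ipBr x y z : ip z (x - y) = ip z x - ip z y.
Proof. by rewrite ipDr ipNr. Qed.

Lemma ip_suml I (s : seq I) (P : pred I) (F : I -> H) z :
  ip (\sum_(i <- s | P i) F i) z = \sum_(i <- s | P i) ip (F i) z.
Proof. by apply: (big_morph (ip^~ z)) => [x y|]; rewrite ?ipDl ?ip0l. Qed.

Lemma ip_sumr I (s : seq I) (P : pred I) (F : I -> H) z :
  ip z (\sum_(i <- s | P i) F i) = \sum_(i <- s | P i) ip z (F i).
Proof. by apply: (big_morph (ip z)) => [x y|]; rewrite ?ipDr ?ip0r. Qed.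

Lemma hnorm_ge0 x : 0 <= N x.
Proof. exact: sqrtr_ge0. Qed.

Lemma ip_self x : ip x x = ((N x ^+ 2)%:C)%C.
Proof.
have [_ _ /(_ x) [im0 re0] _] := hip.
rewrite /hnorm sqr_sqrtr //; case: (ip x x) im0 re0 => a b /= -> //.
Qed.

Lemma hnorm0 : N 0 = 0.
Proof. by rewrite /hnorm ip0l sqrtr0. Qed.

Lemma hnorm_eq0 x : N x = 0 -> x = 0.
Proof. by move=> x0; case: hip => _ _ _; apply; rewrite ip_self x0 expr0n. Qed.

Lemma ip_self_eq0 x : ip x x = 0 -> x = 0.
Proof. by case: hip => _ _ _; apply. Qed.

Lemma hnorm_gt0 x : x <> 0 -> 0 < N x.
Proof.
by move=> x0; rewrite lt_neqAle hnorm_ge0 andbT eq_sym; apply/eqP => /hnorm_eq0.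
Qed.

Lemma Re_sym x y : complex.Re (ip y x) = complex.Re (ip x y).
Proof. by rewrite ipC; case: (ip x y). Qed.

Lemma hnorm_sqrD x y :
  N (x + y) ^+ 2 = N x ^+ 2 + 2 * complex.Re (ip x y) + N y ^+ 2.
Proof.
have : complex.Re (ip (x + y) (x + y)) = N (x + y) ^+ 2 by rewrite ip_self.
move=> <-; rewrite ipDl !ipDr !ip_self [ip y x]ipC.
by case: (ip x y) => a b /=; ring.
Qed.

Lemma hnormZ a x : N (a *: x) = nc a * N x.
Proof.
apply: (pexpIrn (n := 2)) => //; rewrite ?nnegrE ?mulr_ge0 ?nc_ge0 ?hnorm_ge0//.
apply: complexI; rewrite -ip_self ipZl ipZr ip_self mulrA mulc_conj exprMn.
by rewrite [in RHS]rmorphM.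
Qed.

Lemma hnorm_normalized x : x <> 0 -> N ((((N x)^-1)%:C)%C *: x) = 1.
Proof.
move=> /hnorm_gt0 x0; rewrite hnormZ nc_real ger0_norm ?invr_ge0 ?hnorm_ge0//.
by rewrite mulVf ?gt_eqF.
Qed.

Lemma hnormN x : N (- x) = N x.
Proof. by rewrite -scaleN1r hnormZ normcN ComplexField.Normc.normc1 mul1r. Qed.

Lemma hdistC x y : N (x - y) = N (y - x).
Proof. by rewrite -hnormN opprB. Qed.

Lemma hnorm_sqrB x y :
  N (x - y) ^+ 2 = N x ^+ 2 - 2 * complex.Re (ip x y) + N y ^+ 2.
Proof. by rewrite hnorm_sqrD hnormN ipNr raddfN /= mulrN. Qed.

(** The vector [|y|^2 x - <x, y> y] has squared norm [|y|^2 (|x|^2 |y|^2 - |<x, y>|^2)], which is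
    nonnegative; this scaling avoids dividing by [|y|^2]. *)
Lemma cauchy_schwarz x y : nc (ip x y) <= N x * N y.
Proof.
have [->|/eqP /hnorm_gt0 y0] := eqVneq y 0.
  by rewrite ip0r ComplexField.Normc.normc0 mulr_ge0 ?hnorm_ge0.
rewrite -ler_sqr ?nnegrE ?mulr_ge0 ?nc_ge0 ?hnorm_ge0//.
have b0 : 0 < N y ^+ 2 by rewrite exprn_gt0.
have := sqr_ge0 (N (((N y ^+ 2)%:C)%C *: x - ip x y *: y)).
rewrite hnorm_sqrB !hnormZ ipZl ipZr [conjc _ * _]mulrC mulc_conj -rmorphM.
rewrite nc_real ger0_norm ?sqr_ge0//=.
set A := nc (ip x y); set X := N x; set Y := N y in b0 *.
have -> : (Y ^+ 2 * X) ^+ 2 - 2 * (Y ^+ 2 * A ^+ 2) + (A * Y) ^+ 2 =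
   Y ^+ 2 * ((X * Y) ^+ 2 - A ^+ 2) by ring.
by rewrite pmulr_rge0// subr_ge0.
Qed.

Lemma le_hnormD x y : N (x + y) <= N x + N y.
Proof.
rewrite -ler_sqr ?nnegrE ?addr_ge0 ?hnorm_ge0// hnorm_sqrD sqrrD.
have := cauchy_schwarz x y; have := Re_le_nc (ip x y).
have := ler_norm (complex.Re (ip x y)); lra.
Qed.

Lemma le_hnormB x y : N (x - y) <= N x + N y.
Proof. by rewrite (le_trans (le_hnormD _ _))// hnormN. Qed.

Lemma hdistD x y z : N (x - z) <= N (x - y) + N (y - z).
Proof. by have := le_hnormD (x - y) (y - z); rewrite addrA subrK. Qed.

Lemma hnorm_sub_ge x y : N x - N y <= N (x - y).
Proof. by rewrite lerBlDr; have := le_hnormD (x - y) y; rewrite subrK. Qed.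

Lemma hnorm_sum I (s : seq I) (F : I -> H) :
  N (\sum_(i <- s) F i) <= \sum_(i <- s) N (F i).
Proof.
elim: s => [|i s IH]; first by rewrite !big_nil hnorm0.
by rewrite !big_cons (le_trans (le_hnormD _ _))// lerD.
Qed.

(* Orthonormal system indexed by [D]; off [D] the family is extended by 0, so
   that sums need not be restricted to [D]. *)
Definition orthosystem (I : eqType) (D : pred I) (e : I -> H) : Prop :=
  forall i j, ip (e i) (e j) = ((i == j) && D i)%:R.

(** Repetitions in [s] are allowed, so [uniq s] is asked for separately. *)
Definition orthonormal_seq (s : seq H) : Prop :=
  {in s &, forall x y, ip x y = (x == y)%:R}.

(** * Finite orthonormal expansions and Bessel's inequality *)

Section Orthosystem.
Variables (I : eqType) (D : pred I) (e : I -> H).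
Hypothesis oe : orthosystem D e.

Lemma ortho_out i : ~~ D i -> e i = 0.
Proof. by move=> Di; apply: ip_self_eq0; rewrite oe (negbTE Di) andbF. Qed.

Lemma ortho_in i : D i -> N (e i) = 1.
Proof. by move=> Di; rewrite /hnorm oe eqxx Di sqrtr1. Qed.

Lemma ip_comb (s : seq I) (c : I -> R[i]) j : uniq s ->
  ip (\sum_(i <- s) c i *: e i) (e j) = if (j \in s) && D j then c j else 0.
Proof.
move=> us; rewrite ip_suml.
under eq_bigr do rewrite ipZl oe.
have [Dj|nDj] := boolP (D j); last first.
  rewrite andbF big1// => i _; case: eqP => [->|_] /=; rewrite ?(negbTE nDj) ?mulr0//.
rewrite andbT; have [js|njs] := boolP (j \in s).
  rewrite (bigD1_seq j)//= eqxx Dj mulr1 big1 ?addr0// => i /negbTE ->.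
  by rewrite mulr0.
rewrite big_seq big1// => i is_; case: eqP => [ij|]; rewrite ?mulr0//.
by rewrite -ij is_ in njs.
Qed.

Lemma hnorm_comb (s : seq I) (c : I -> R[i]) : uniq s ->
  N (\sum_(i <- s) c i *: e i) ^+ 2 = \sum_(i <- s | D i) nc (c i) ^+ 2.
Proof.
move=> us; apply: complexI; rewrite -ip_self {2}big_seq ip_sumr rmorph_sum /=.
rewrite [RHS]big_mkcond [RHS]big_seq; apply: eq_bigr => j js.
rewrite ipZr ip_comb// js /=; case: (D j); rewrite ?mulr0//.
by rewrite mulrC mulc_conj.
Qed.

Lemma ip_comb_self (s : seq I) x : uniq s ->
  ip (\sum_(i <- s) ip x (e i) *: e i) x = ((\sum_(i <- s) nc (ip x (e i)) ^+ 2)%:C)%C.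
Proof.
move=> us; rewrite ip_suml rmorph_sum; apply: eq_bigr => i _ /=.
by rewrite ipZl [ip (e i) x]ipC mulc_conj.
Qed.

Lemma sum_coef_in (s : seq I) x : 
  \sum_(i <- s | D i) nc (ip x (e i)) ^+ 2 = \sum_(i <- s) nc (ip x (e i)) ^+ 2.
Proof.
rewrite big_mkcond; apply: eq_bigr => i _; case: ifP => // /negbT/ortho_out ->.
by rewrite ip0r ComplexField.Normc.normc0 expr0n.
Qed.

(** Pythagoras: the subtracted sum is the orthogonal projection of [x], so its squared norm and its
    inner product with [x] are both the sum of squared coefficients. *)
Lemma bessel_eq (s : seq I) x : uniq s ->
  N (x - \sum_(i <- s) ip x (e i) *: e i) ^+ 2 =
  N x ^+ 2 - \sum_(i <- s) nc (ip x (e i)) ^+ 2.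
Proof.
move=> us; rewrite hnorm_sqrB hnorm_comb// sum_coef_in Re_sym ip_comb_self//=; ring.
Qed.

Lemma bessel (s : seq I) x : uniq s ->
  \sum_(i <- s) nc (ip x (e i)) ^+ 2 <= N x ^+ 2.
Proof. by move=> us; rewrite -subr_ge0 -bessel_eq// sqr_ge0. Qed.

End Orthosystem.

(** A list of vectors serves as a system indexed by [H] itself, so that [ip_comb] and [bessel_eq]
    apply to it. *)
Lemma orthosystem_seq (s : seq H) : orthonormal_seq s ->
  orthosystem (mem s) (fun x => if x \in s then x else 0).
Proof.
move=> os x y /=; have [xs|xs] := boolP (x \in s); last by rewrite ip0l andbF.
have [ys|ys] := boolP (y \in s); first by rewrite os// andbT.
by rewrite ip0r; case: eqP => // xy; rewrite -xy xs in ys.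
Qed.

Lemma ip_cvg_bound (u : nat -> H) l y : hconverges_to ip u l ->
  forall eps : R, 0 < eps -> \forall n \near \oo, nc (ip (u n) y - ip l y) < eps.
Proof.
move=> ul eps e0.
(* The [+ 1] keeps the divisor positive when [y = 0]. *)
have Ny : 0 < N y + 1 by rewrite ltr_wpDl ?hnorm_ge0.
have := ul; rewrite /hconverges_to => /cvgrPdist_lt /(_ (eps / (N y + 1))).
rewrite divr_gt0// => /(_ isT); apply: filterS => n.
rewrite sub0r normrN ger0_norm ?hnorm_ge0// ltr_pdivlMr// => h.
rewrite -ipBl; apply: le_lt_trans h; apply: le_trans (cauchy_schwarz _ _) _.
by rewrite ler_wpM2l ?hnorm_ge0// lerDl.
Qed.

Lemma complex_eq_eps (z w : R[i]) :
  (forall eps : R, 0 < eps -> nc (z - w) < eps) -> z = w.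
Proof.
move=> h; apply/eqP; rewrite -subr_eq0; apply/eqP.
apply: ComplexField.Normc.eq0_normc; apply/eqP; rewrite eq_le nc_ge0 andbT.
by apply/ler_addgt0Pl => eps /h; rewrite addr0 => /ltW.
Qed.

Lemma ip_lim_eq (u v : nat -> H) l m x y :
  hconverges_to ip u l -> hconverges_to ip v m ->
  (\forall n \near \oo, ip (u n) y = ip (v n) x) -> ip l y = ip m x.
Proof.
move=> ul vm E; apply: complex_eq_eps => eps e0.
have e2 : 0 < eps / 2 by rewrite divr_gt0.
have [n [E1 [E2 E3]]] : exists n, ip (u n) y = ip (v n) x /\
    nc (ip (u n) y - ip l y) < eps / 2 /\ nc (ip (v n) x - ip m x) < eps / 2.
  have : \forall n \near \oo, ip (u n) y = ip (v n) x /\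
    nc (ip (u n) y - ip l y) < eps / 2 /\ nc (ip (v n) x - ip m x) < eps / 2.
    near=> n; split; first by near: n.
    by split; near: n; [exact: ip_cvg_bound ul _ e2|exact: ip_cvg_bound vm _ e2].
  by move=> /filter_ex.
have -> : ip l y - ip m x = (ip l y - ip (u n) y) + (ip (v n) x - ip m x).
  by rewrite -E1; ring.
apply: le_lt_trans (le_normcD _ _) _; rewrite nc_sub [eps]splitr; exact: ltrD.
Unshelve. all: by end_near. Qed.

Lemma ip_lim_cst (u : nat -> H) l y a :
  hconverges_to ip u l -> (\forall n \near \oo, ip (u n) y = a) -> ip l y = a.
Proof.
move=> ul E; apply: complex_eq_eps => eps e0.
have /filter_ex[n [E1]] : \forall n \near \oo, ip (u n) y = a /\ nc (ip (u n) y - ip l y) < eps.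
  by near=> n; split; near: n => //; exact: ip_cvg_bound ul _ e0.
by rewrite E1 nc_sub.
Unshelve. all: by end_near. Qed.

Lemma Re_ip_lim_ge0 (u : nat -> H) l y : hconverges_to ip u l ->
  (forall n, 0 <= complex.Re (ip (u n) y)) -> 0 <= complex.Re (ip l y).
Proof.
move=> ul E; apply/ler_addgt0Pl => eps e0.
have /filter_ex[n h] := ip_cvg_bound y ul e0.
have := le_lt_trans (Re_le_nc _) h; rewrite raddfB /= ltr_norml => /andP[_].
have := E n; lra.
Qed.

(** * Orthogonal series, projections and Parseval expansions *)

Section Series.
Hypothesis hcomplete : forall u : nat -> H, hcauchy ip u -> exists l, hconverges_to ip u l.
Variables (D : pred nat) (e : nat -> H).
Hypothesis oe : orthosystem D e.

(** Riesz-Fischer. The last clause puts [v] in the double orthogonal complement of the system, that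
    is, in its closed span, without mentioning closures. *)
Lemma ortho_series (c : nat -> R[i]) (K : R) :
  (forall n, \sum_(0 <= k < n) nc (c k) ^+ 2 <= K) ->
  exists v, [/\ hconverges_to ip (fun n => \sum_(0 <= k < n) c k *: e k) v,
    forall n, D n -> ip v (e n) = c n &
    forall y, (forall n, ip y (e n) = 0) -> ip v y = 0].
Proof.
move=> cK.
pose S n := \sum_(0 <= k < n) nc (c k) ^+ 2.
have ndS : nondecreasing_seq S.
  move=> m n mn; rewrite /S (big_cat_nat (leq0n m) mn)//= lerDl sumr_ge0// => k _.
  by rewrite sqr_ge0.
have cS : cvgn S.
  apply: nondecreasing_is_cvgn => //; exists K => _ [n _ <-]; exact: cK.
have [v vP] : exists v, hconverges_to ip (fun n => \sum_(0 <= k < n) c k *: e k) v.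
  apply: hcomplete => eps e0.
  have e2 : 0 < eps ^+ 2 by rewrite exprn_gt0.
  have /cvgrPdist_lt /(_ _ e2) [M _ MP] := cS.
  exists M.
  (* By Pythagoras the squared norm of a block of the series is at most the increment
     [S n - S m]. *)
  have key m n : (M <= m)%N -> (m <= n)%N ->
      N (\sum_(0 <= k < n) c k *: e k - \sum_(0 <= k < m) c k *: e k) < eps.
    move=> Mm mn; rewrite (big_cat_nat (leq0n m) mn)//= addrAC subrr add0r.
    rewrite -ltr_sqr ?nnegrE ?hnorm_ge0 ?(ltW e0)//.
    rewrite (hnorm_comb oe) ?iota_uniq//.
    apply: (@le_lt_trans _ _ (S n - S m)).
      rewrite /S (big_cat_nat (leq0n m) mn)//= addrAC subrr add0r [leLHS]big_mkcond.
      by apply: ler_sum => k _; case: ifP => // _; rewrite sqr_ge0.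
    have := MP m Mm; rewrite /= ger0_norm; last first.
      by rewrite subr_ge0; apply: nondecreasing_cvgn_le.
    have := nondecreasing_cvgn_le ndS cS n; lra.
  move=> m n Mm Mn; case: (leqP m n) => mn; last exact: key (ltnW mn).
  by rewrite hdistC; apply: key.
exists v; split => // [n Dn|y yE].
  (* The partial sum runs over [k < m], so the [n]-th coefficient is present from [m = n.+1] on. *)
  apply: ip_lim_cst vP _; exists n.+1 => // m /= nm.
  by rewrite (ip_comb oe) ?iota_uniq// mem_index_iota /= nm Dn.
apply: ip_lim_cst vP _; near=> n.
by rewrite ip_suml big1// => k _; rewrite ipZl ipC yE conjc0 mulr0.
Unshelve. all: by end_near. Qed.

Lemma ortho_proj x : exists v,
  [/\ hconverges_to ip (fun n => \sum_(0 <= k < n) ip x (e k) *: e k) v,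
      forall n, ip (x - v) (e n) = 0 &
      forall y, (forall n, ip y (e n) = 0) -> ip v y = 0].
Proof.
have [|v [v1 v2 v3]] := @ortho_series (fun k => ip x (e k)) (N x ^+ 2).
  by move=> n; apply: (bessel oe); rewrite iota_uniq.
exists v; split=> // n; rewrite ipBl; have [Dn|/(ortho_out oe) ->] := boolP (D n).
  by rewrite v2// subrr.
by rewrite !ip0r subrr.
Qed.

(** The difference of [x] and its projection is orthogonal to the system, hence 0 by
    completeness. *)
Lemma parseval x : (forall y, (forall n, ip y (e n) = 0) -> y = 0) ->
  hconverges_to ip (fun n => \sum_(0 <= k < n) ip x (e k) *: e k) x.
Proof.
move=> eC; have [v [v1 /eC/eqP]] := ortho_proj x.
by rewrite subr_eq0 => /eqP xv _; rewrite -xv in v1.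
Qed.

End Series.
End InnerProduct.

(** * Sums over finite lists and convexity of powers *)

Section FiniteSums.
Context {R : realType}.

(** An [esum] is a supremum over finite sets, and each of these is enumerated by a duplicate-free
    list. *)
Lemma esum_le_seq (I : choiceType) (A : set I) (a : I -> R) (C : R) :
  (forall s : seq I, uniq s -> {in s, forall i, A i} -> \sum_(i <- s) a i <= C) ->
  (\esum_(i in A) (a i)%:E <= C%:E)%E.
Proof.
move=> h; apply: ub_ereal_sup => _ [F [finF FA] <-].
rewrite fsbig_finite//= sumEFin lee_fin; apply: h; first exact: finmap.fset_uniq.
by move=> i; rewrite in_fset_set// => /set_mem/FA.
Qed.

Lemma esum_ge_seq (I : choiceType) (A : set I) (a : I -> R) (C : \bar R) (s : seq I) :
  (\esum_(i in A) (a i)%:E <= C)%E -> uniq s -> {in s, forall i, A i} ->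
  ((\sum_(i <- s) a i)%:E <= C)%E.
Proof.
move=> h us sA; apply: le_trans h; rewrite -sumEFin (fsbig_seq _ _ us).
by apply: ereal_sup_ubound; exists [set` s] => //; split => // i /sA.
Qed.

(* Bernoulli's inequality, i.e. the tangent line of [y `^ q] at 1, read off
   Young's inequality. *)
Lemma powR_tangent (y q : R) : 0 <= y -> 1 <= q -> 1 + q * (y - 1) <= y `^ q.
Proof.
move=> y0; rewrite le_eqVlt => /predU1P[<-|q1]; first by rewrite powRr1//; lra.
have q0 : 0 < q by lra.
have h : q^-1 + (1 - q^-1) = 1 by ring.
have V0 : 0 < 1 - q^-1 by rewrite subr_gt0 invf_lt1.
have := @conjugate_powR R y 1 q (1 - q^-1)^-1 y0 ler01 q0.
rewrite invr_gt0 V0 invrK h => /(_ isT erefl); rewrite powR1 mulr1 mul1r.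
rewrite -(ler_pM2l q0) mulrDr mulrCA mulfV ?gt_eqF// mulr1 mulrBr mulfV ?gt_eqF//; lra.
Qed.

(** Jensen's inequality for the power [q = p / 2]: after division by the weighted sum [t], each term
    is bounded below by the tangent line at 1. A total weight below 1 is harmless because the
    constant term [1 - q] of that line is at most 0. *)
Lemma powR_jensen (I : Type) (s : seq I) (w a : I -> R) (p : R) : 2 <= p ->
  (forall i, 0 <= w i) -> (forall i, 0 <= a i) -> \sum_(i <- s) w i <= 1 ->
  (\sum_(i <- s) w i * a i ^+ 2) `^ (p / 2) <= \sum_(i <- s) w i * a i `^ p.
Proof.
move=> p2 w0 a0 W1; set t := \sum_(i <- s) _; set q := p / 2.
have q1 : 1 <= q by rewrite /q; lra.
have rhs0 : 0 <= \sum_(i <- s) w i * a i `^ p.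
  by apply: sumr_ge0 => i _; rewrite mulr_ge0 ?powR_ge0.
have : 0 <= t by apply: sumr_ge0 => i _; rewrite mulr_ge0 ?sqr_ge0.
rewrite le_eqVlt => /predU1P[<-|t0]; first by rewrite powR0// gt_eqF//; lra.
have aE i : a i `^ p = (a i ^+ 2 / t) `^ q * t `^ q.
  rewrite -powRM ?divr_ge0 ?sqr_ge0 ?(ltW t0)// divfK ?gt_eqF//.
  rewrite -powR_mulrn// -powRrM; congr (_ `^ _); rewrite /q; lra.
have -> : \sum_(i <- s) w i * a i `^ p =
    (\sum_(i <- s) w i * (a i ^+ 2 / t) `^ q) * t `^ q.
  by rewrite mulr_suml; apply: eq_bigr => i _; rewrite aE mulrA.
rewrite -[leLHS]mul1r ler_wpM2r ?powR_ge0//.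
apply: (@le_trans _ _ (\sum_(i <- s) w i * (1 + q * (a i ^+ 2 / t - 1)))); last first.
  by apply: ler_sum => i _; rewrite ler_wpM2l// powR_tangent// divr_ge0 ?sqr_ge0// ltW.
(* By the choice of [t], the weighted sum of the [a i ^+ 2 / t] is [t / t]. *)
have -> : \sum_(i <- s) w i * (1 + q * (a i ^+ 2 / t - 1)) =
    (1 - q) * \sum_(i <- s) w i + q * (t / t).
  rewrite /t mulr_suml !mulr_sumr -big_split /=; apply: eq_bigr => i _; ring.
rewrite mulfV ?gt_eqF// mulr1.
have : (q - 1) * (\sum_(i <- s) w i) <= (q - 1) * 1 by rewrite ler_wpM2l// subr_ge0.
lra.
Qed.

End FiniteSums.

(** * Bounded operators, adjoints and eigenvectors of [Ts \o T] *)

Section Operators.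
Variables (R : realType) (H : lmodType R[i]) (ip : H -> H -> R[i]).
Hypothesis hip : inner_product_axioms ip.
Local Notation N := (hnorm ip).
Variables (T Ts : H -> H) (M : R).
Hypothesis linT : linear T.

Lemma op_add x y : T (x + y) = T x + T y.
Proof. by have := linT 1 x y; rewrite !scale1r. Qed.

Lemma op_zero : T 0 = 0.
Proof. by apply: (addrI (T 0)); rewrite -op_add !addr0. Qed.

Lemma op_scale a x : T (a *: x) = a *: T x.
Proof. by have := linT a x 0; rewrite !addr0 op_zero addr0. Qed.

Lemma op_sub x y : T (x - y) = T x - T y.
Proof. by rewrite op_add -scaleN1r op_scale scaleN1r. Qed.

Lemma op_sum I (s : seq I) (F : I -> H) : T (\sum_(i <- s) F i) = \sum_(i <- s) T (F i).
Proof. by apply: (big_morph T) => [x y|]; rewrite ?op_add ?op_zero. Qed.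

Hypothesis M0 : 0 <= M.
Hypothesis bdT : forall x, N (T x) <= M * N x.

Lemma op_cvg (u : nat -> H) l :
  hconverges_to ip u l -> hconverges_to ip (fun n => T (u n)) (T l).
Proof.
rewrite /hconverges_to => ul; apply: (@squeeze_cvgr _ _ _ _ (fun=> 0) (fun n => M * N (u n - l))).
- by near=> n; rewrite hnorm_ge0 -op_sub bdT.
- exact: cvg_cst.
- by rewrite -(mulr0 M); apply: cvgMr.
Unshelve. all: by end_near. Qed.

Hypothesis adj : is_adjoint ip T Ts.

Lemma adjoint_sym x y : ip y (T x) = ip (Ts y) x.
Proof. by rewrite (ipC hip) adj -(ipC hip). Qed.

(** One has [|Ts y|^2 = <T (Ts y), y> <= M |Ts y| |y|], and a factor [|Ts y|] cancels. *)
Lemma adjoint_bounded y : N (Ts y) <= M * N y.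
Proof.
have [-> |/eqP/(hnorm_gt0 hip) y0] := eqVneq (Ts y) 0.
  by rewrite hnorm0// mulr_ge0 ?hnorm_ge0.
rewrite -(ler_pM2l y0) -expr2.
have -> : N (Ts y) ^+ 2 = complex.Re (ip (T (Ts y)) y) by rewrite adj ip_self.
apply: le_trans (ler_norm _) _; apply: le_trans (Re_le_nc _) _.
apply: le_trans (cauchy_schwarz hip _ _) _.
by rewrite mulrA [_ * M]mulrC ler_wpM2r ?hnorm_ge0.
Qed.

(** The defect of linearity is orthogonal to itself, as each [Ts] can be moved back to a [T]. *)
Lemma adjoint_linear : linear Ts.
Proof.
move=> a x y; apply/eqP; rewrite -subr_eq0; apply/eqP; apply: (ip_self_eq0 hip).
set v := _ - _; rewrite /v ipBr// -adj ipDr// ipDr// ipZr// ipZr// -!adj; ring.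
Qed.

Lemma gram_selfadjoint x y : ip (Ts (T x)) y = ip x (Ts (T y)).
Proof. by rewrite -adjoint_sym adj. Qed.

Lemma gram_self x : ip (Ts (T x)) x = ((N (T x) ^+ 2)%:C)%C.
Proof. by rewrite -adjoint_sym ip_self. Qed.

(* A maximising sequence for [N (T x)] on the unit sphere of the orthogonal
   complement of [E] is asymptotically an eigenvector of [Ts \o T], and
   compactness makes it converge. *)
Lemma compact_eigenvector (E : set H) : compact_op ip T ->
  (forall x, (forall e, E e -> ip x e = 0) -> forall e, E e -> ip (Ts (T x)) e = 0) ->
  (exists x, (forall e, E e -> ip x e = 0) /\ T x <> 0) ->
  exists z (s : R), [/\ forall e, E e -> ip z e = 0, z <> 0, 0 < s &
    Ts (T z) = ((s ^+ 2)%:C)%C *: z].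
Proof.
move=> cT stab [x0 [x0E Tx0]].
pose P x := forall e, E e -> ip x e = 0.
have PZ a x : P x -> P (a *: x) by move=> Px e Ee; rewrite ipZl// Px ?mulr0.
pose V := [set N (T x) | x in [set x | P x /\ N x = 1]].
have VP x : P x -> x <> 0 -> V (N (T x) / N x).
  move=> Px xn0; exists ((((N x)^-1)%:C)%C *: x).
    by split; [exact: PZ|exact: hnorm_normalized].
  by rewrite op_scale hnormZ// nc_real ger0_norm ?invr_ge0 ?hnorm_ge0// mulrC.
have ubV : ubound V M by move=> _ [x [_ x1] <-]; rewrite (le_trans (bdT x))// x1 mulr1.
have x0n0 : x0 <> 0 by move=> x00; apply: Tx0; rewrite x00 op_zero.
have supV : has_sup V by split; [exists (N (T x0) / N x0); exact: VP | exists M].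
(* This is the norm of [T] restricted to the orthogonal complement of [E]. *)
pose s := sup V.
have s0 : 0 < s.
  apply: (@lt_le_trans _ _ (N (T x0) / N x0)); last by apply: ub_le_sup; [exists M|exact: VP].
  by rewrite divr_gt0 ?(hnorm_gt0 hip).
have bnd x : P x -> N (T x) <= s * N x.
  move=> Px; have [->|/eqP xn0] := eqVneq x 0; first by rewrite op_zero hnorm0 ?mulr0.
  rewrite -ler_pdivrMr ?(hnorm_gt0 hip)//; apply: ub_le_sup; first by exists M.
  exact: VP.
(* By [stab] the vector [Ts (T x)] stays in the complement, so [bnd] applies to it in
   [|Ts (T x)|^2 = <T (Ts (T x)), T x>]. *)
have Abnd x : P x -> N (Ts (T x)) <= s * N (T x).
  move=> Px; have [->|/eqP/(hnorm_gt0 hip) y0] := eqVneq (Ts (T x)) 0.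
    by rewrite hnorm0// mulr_ge0 ?hnorm_ge0 ?ltW.
  rewrite -(ler_pM2l y0) -expr2.
  have -> : N (Ts (T x)) ^+ 2 = complex.Re (ip (T (Ts (T x))) (T x)) by rewrite adj ip_self.
  apply: le_trans (ler_norm _) _; apply: le_trans (Re_le_nc _) _.
  apply: le_trans (cauchy_schwarz hip _ _) _.
  by rewrite mulrA [_ * s]mulrC ler_wpM2r ?hnorm_ge0// bnd//; exact: stab.
(* With [t = N (T x)], the left side is at most [s^4 - s^2 t^2], which falls short of the right side
   by [s^2 (s - t)^2]. *)
have key x : P x -> N x = 1 ->
    N (Ts (T x) - ((s ^+ 2)%:C)%C *: x) ^+ 2 <= 2 * s ^+ 3 * (s - N (T x)).
  move=> Px x1; rewrite hnorm_sqrB// ipZr// conjc_real gram_self -rmorphM hnormZ// x1.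
  rewrite mulr1 nc_real ger0_norm ?sqr_ge0//=.
  have h1 := Abnd x Px; have h2 := bnd x Px; rewrite x1 mulr1 in h2.
  have h0 := hnorm_ge0 ip (T x); have h3 := hnorm_ge0 ip (Ts (T x)).
  have : N (Ts (T x)) ^+ 2 <= (s * N (T x)) ^+ 2.
    by rewrite ler_sqr ?nnegrE// mulr_ge0// ltW.
  have : 0 <= s ^+ 2 * (s - N (T x)) ^+ 2 by rewrite mulr_ge0 ?sqr_ge0.
  rewrite !exprS !expr0 !mulr1; nra.
have /choice[u uP] : forall n : nat, exists x, [/\ P x, N x = 1 & s - n.+1%:R^-1 < N (T x)].
  move=> n; have n0 : 0 < n.+1%:R^-1 :> R by rewrite invr_gt0.
  by have [_ [x [Px x1] <-] h] := sup_adherent n0 supV; exists x.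
have [phi [phi_inc [l Tl]]] : exists phi : nat -> nat, (forall n, (phi n < phi n.+1)%N) /\
      exists l : H, hconverges_to ip (fun n => T (u (phi n))) l.
  by apply: cT; exists 1 => n; have [_ -> _] := uP n.
have phi_ge n : (n <= phi n)%N.
  by elim: n => // n IH; apply: leq_ltn_trans IH (phi_inc n).
pose x n := u (phi n).
have F1 eps : 0 < eps -> \forall n \near \oo, s - eps < N (T (x n)).
  move=> e0; near=> n; have [_ _] := uP (phi n); apply: lt_trans.
  rewrite ltrD2l ltrN2; apply: (@le_lt_trans _ _ (n.+1%:R^-1)).
    by rewrite lef_pV2 ?posrE// ler_nat ltnS.
  near: n; exact: (near_infty_natSinv_lt (PosNum e0)).
have F2 eps : 0 < eps -> \forall n \near \oo,
    N (Ts (T (x n)) - ((s ^+ 2)%:C)%C *: x n) < eps.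
  move=> e0; have s3 : 0 < 2 * s ^+ 3 by rewrite mulr_gt0// exprn_gt0.
  have d0 : 0 < eps ^+ 2 / (2 * s ^+ 3) by rewrite divr_gt0// exprn_gt0.
  apply: filterS (F1 _ d0) => n h; have [Pn n1 _] := uP (phi n).
  rewrite -ltr_sqr ?nnegrE ?hnorm_ge0 ?ltW//; apply: le_lt_trans (key _ Pn n1) _.
  by rewrite mulrC -ltr_pdivlMr// ltrBlDr addrC -ltrBlDr.
(* Since [T (x n)] tends to [l] and [Ts (T (x n)) - s^2 x n] tends to 0, the only possible limit of
   [x n] is [s^-2 Ts l]. *)
pose z := ((s ^- 2)%:C)%C *: Ts l.
have s2 : 0 < s ^+ 2 by rewrite exprn_gt0.
have F3 : hconverges_to ip x z.
  apply/cvgrPdist_lt => eps e0.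
  have eps2 : 0 < s ^+ 2 * eps / 2 by rewrite divr_gt0// mulr_gt0.
  have eps3 : 0 < s ^+ 2 * eps / 2 / (M + 1) by rewrite divr_gt0// ltr_wpDl.
  near=> n; rewrite sub0r normrN ger0_norm ?hnorm_ge0//.
  rewrite -(ltr_pM2l s2) -[s ^+ 2 in ltLHS]ger0_norm ?ltW// -nc_real -hnormZ// scalerBr.
  rewrite /z scalerA -rmorphM mulfV ?gt_eqF// scale1r.
  apply: le_lt_trans (hdistD hip _ (Ts (T (x n))) _) _.
  rewrite [ltRHS]splitr; apply: ltrD.
    by rewrite hdistC//; near: n; apply: F2.
  have -> : Ts (T (x n)) - Ts l = Ts (T (x n) - l).
    have := adjoint_linear (-1) l (T (x n)); rewrite !scaleN1r addrC => <-.
    by rewrite addrC.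
  apply: le_lt_trans (adjoint_bounded _) _.
  apply: (@le_lt_trans _ _ ((M + 1) * N (T (x n) - l))).
    by rewrite ler_wpM2r ?hnorm_ge0// lerDl.
  rewrite mulrC -ltr_pdivlMr ?ltr_wpDl//.
  near: n; have /cvgrPdist_lt/(_ _ eps3) := Tl; apply: filterS => n.
  by rewrite sub0r normrN ger0_norm ?hnorm_ge0.
have zn0 : z <> 0.
  move=> z0; have /cvgrPdist_lt/(_ 1 ltr01)/filter_ex[n] := F3.
  rewrite z0 subr0 sub0r normrN ger0_norm ?hnorm_ge0//.
  by have [_ -> _] := uP (phi n); rewrite ltxx.
exists z, s; split => //.
  move=> e Ee; apply: (ip_lim_cst hip F3); near=> n.
  by have [Pn _ _] := uP (phi n); apply: Pn.
apply/eqP; rewrite -subr_eq0; apply/eqP; apply: (hnorm_eq0 hip).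
apply/eqP; rewrite eq_le hnorm_ge0 andbT; apply/ler_addgt0Pl => eps e0; rewrite addr0.
(* Here [M * M] and [s ^+ 2] are the factors of [N (x n - z)] in [g1] and [g2], and 1 is that of the
   residual from [F2]. *)
have K0 : 0 < M * M + 1 + s ^+ 2 by rewrite ltr_wpDr ?ltW// ltr_wpDl ?mulr_ge0.
have d0 : 0 < eps / (M * M + 1 + s ^+ 2) by rewrite divr_gt0.
have /filter_ex[n [h1 h2]] : \forall n \near \oo,
   N (x n - z) < eps / (M * M + 1 + s ^+ 2) /\
   N (Ts (T (x n)) - ((s ^+ 2)%:C)%C *: x n) < eps / (M * M + 1 + s ^+ 2).
  near=> n; split; near: n; last exact: F2.
  have /cvgrPdist_lt/(_ _ d0) := F3; apply: filterS => n.
  by rewrite sub0r normrN ger0_norm ?hnorm_ge0.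
apply: le_trans (hdistD hip _ (Ts (T (x n))) _) _.
have g1 : N (Ts (T z) - Ts (T (x n))) <= M * M * N (x n - z).
  have -> : Ts (T z) - Ts (T (x n)) = Ts (T (z - x n)).
    have := adjoint_linear (-1) (T (x n)) (T z); rewrite !scaleN1r addrC => <-.
    by rewrite addrC op_sub.
  apply: le_trans (adjoint_bounded _) _; rewrite -mulrA ler_wpM2l//.
  by rewrite [N (x n - z)]hdistC.
have g2 : N (Ts (T (x n)) - ((s ^+ 2)%:C)%C *: z) <=
    N (Ts (T (x n)) - ((s ^+ 2)%:C)%C *: x n) + s ^+ 2 * N (x n - z).
  apply: le_trans (hdistD hip _ (((s ^+ 2)%:C)%C *: x n) _) _; rewrite lerD2l.
  by rewrite -scalerBr hnormZ// nc_real ger0_norm// ltW.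
set d := eps / _ in h1 h2 d0.
have dE : eps = (M * M + 1 + s ^+ 2) * d by rewrite /d mulrCA mulfV ?mulr1// gt_eqF.
rewrite dE.
have : (M * M + s ^+ 2) * N (x n - z) <= (M * M + s ^+ 2) * d.
  by rewrite ler_wpM2l ?ltW// ltr_wpDl ?mulr_ge0.
move: g1 g2 h2; lra.
Unshelve. all: by end_near. Qed.

End Operators.

(** Convexity: the power function lies above a supporting line at [t], of slope [K]. This one-sided
    estimate takes the place of continuity in the limit passage of [diag_bessel_bound]. *)
Lemma powR_lower_tangent (R : realType) (t p : R) : 0 <= t -> 1 <= p ->
  exists2 K, 0 <= K & forall b, 0 <= b -> t `^ p <= b `^ p + K * (t - b).
Proof.
rewrite le_eqVlt => /predU1P[<-|t0] p1.
  by exists 0 => // b b0; rewrite mul0r addr0 powR0 ?powR_ge0// gt_eqF//; lra.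
have tp : 0 <= t `^ p by rewrite powR_ge0.
exists (p * (t `^ p / t)); first by rewrite mulr_ge0 ?divr_ge0 ?(ltW t0)//; lra.
move=> b b0; have y0 : 0 <= b / t by rewrite divr_ge0// ltW.
have := ler_wpM2r tp (powR_tangent y0 p1).
rewrite -powRM ?(ltW t0)// divfK ?gt_eqF//.
have -> : p * (t `^ p / t) * (t - b) = p * t `^ p * (t / t) - p * t `^ p * (b / t) by ring.
rewrite mulfV ?gt_eqF//; lra.
Qed.

(** * Sums over Bessel families when [Ts \o T] is diagonal *)

Section SchattenBound.
Variables (R : realType) (H : lmodType R[i]) (ip : H -> H -> R[i]).
Hypothesis hip : inner_product_axioms ip.
Hypothesis hcomplete :
  forall u : nat -> H, hcauchy ip u -> exists l, hconverges_to ip u l.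
Local Notation N := (hnorm ip).
Variables (T Ts : H -> H) (M : R).
Hypothesis linT : linear T.
Hypothesis M0 : 0 <= M.
Hypothesis bdT : forall x, N (T x) <= M * N x.
Hypothesis adj : is_adjoint ip T Ts.

(** The common feature of orthonormal bases and frames with upper bound at most 1 on which the
    estimate rests; finite lists avoid infinite sums. *)
Definition bessel_family (I : eqType) (f : I -> H) : Prop :=
  forall (x : H) (s : seq I), uniq s -> \sum_(i <- s) nc (ip x (f i)) ^+ 2 <= N x ^+ 2.

(** Testing the condition on [f i] itself gives [|f i|^4 <= |f i|^2]. *)
Lemma bessel_family_le1 (I : eqType) (f : I -> H) i : bessel_family f -> N (f i) <= 1.
Proof.
move=> bf; have := bf (f i) [:: i] isT; rewrite big_seq1 ip_self// nc_real.
rewrite ger0_norm ?sqr_ge0//; have [->|] := eqVneq (N (f i)) 0; first by [].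
move=> f0; have {f0} f0 : 0 < N (f i) by rewrite lt_neqAle eq_sym f0 hnorm_ge0.
move=> h; have : N (f i) ^+ 2 <= 1 by rewrite -(ler_pM2l (exprn_gt0 2 f0)) mulr1 -expr2.
by rewrite expr_le1// ltW.
Qed.

Section Diagonal.
Variables (D : pred nat) (e : nat -> H) (lam : nat -> R).
Hypothesis oe : orthosystem ip D e.
Hypothesis Ae : forall n, Ts (T (e n)) = ((lam n ^+ 2)%:C)%C *: e n.
Hypothesis lam0 : forall n, 0 <= lam n.
Hypothesis kerT : forall x, (forall n, ip x (e n) = 0) -> T x = 0.

(** One has [|T y|^2 = <Ts (T y), y>], and [Ts \o T] multiplies [e k] by [lam k ^+ 2]. *)
Lemma diag_partial_sqr n x :
  N (T (\sum_(0 <= k < n) ip x (e k) *: e k)) ^+ 2 =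
  \sum_(0 <= k < n) nc (ip x (e k)) ^+ 2 * lam k ^+ 2.
Proof.
have linTs := adjoint_linear hip adj.
apply: complexI; rewrite -(gram_self hip adj).
rewrite (op_sum linT) (op_sum linTs).
under [X in ip X _]eq_bigr => k _ do rewrite (op_scale linT) (op_scale linTs) Ae scalerA.
rewrite ip_sumr// rmorph_sum /= big_seq [RHS]big_seq; apply: eq_bigr => k kn.
rewrite ipZr// (ip_comb hip oe) ?iota_uniq// kn /=.
have [Dk|/(ortho_out hip oe) ->] := boolP (D k).
  by rewrite mulrA [conjc _ * _]mulrC mulc_conj -rmorphM.
by rewrite ip0r// ComplexField.Normc.normc0 expr0n mul0r mulr0.
Qed.

(** The difference of [x] and its projection on the closed span of the [e n] lies in the kernel of
    [T], and [T] is continuous. *)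
Lemma diag_partial_cvg x :
  hconverges_to ip (fun n => T (\sum_(0 <= k < n) ip x (e k) *: e k)) (T x).
Proof.
have [v [v1 v2 _]] := ortho_proj hip hcomplete oe x.
have -> : T x = T v.
  by apply/eqP; rewrite -subr_eq0 -(op_sub linT) kerT.
exact: op_cvg v1.
Qed.

(** For the truncations [P n], Jensen is applied over [k], where the weights sum to at most
    [|f i|^2 <= 1]; after exchanging the sums, the weights over [i] sum to at most [|e k|^2 <= 1].
    Then [n] tends to infinity. *)
Lemma diag_bessel_bound (p L : R) (I : eqType) (f : I -> H) (s : seq I) : 2 <= p ->
  (forall n, \sum_(0 <= k < n) lam k `^ p <= L) ->
  bessel_family f -> uniq s -> \sum_(i <- s) N (T (f i)) `^ p <= L.
Proof.
move=> p2 lamL bf us.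
have p1 : 1 <= p by lra.
pose P n x := \sum_(0 <= k < n) ip x (e k) *: e k.
have ubP n : \sum_(i <- s) N (T (P n (f i))) `^ p <= L.
  apply: le_trans (lamL n).
  apply: (@le_trans _ _ (\sum_(i <- s) \sum_(0 <= k < n) nc (ip (f i) (e k)) ^+ 2 * lam k `^ p)).
    apply: ler_sum => i _.
    have -> : N (T (P n (f i))) `^ p = (N (T (P n (f i))) ^+ 2) `^ (p / 2).
      by rewrite -powR_mulrn ?hnorm_ge0// -powRrM; congr (_ `^ _); lra.
    rewrite diag_partial_sqr; apply: powR_jensen => // [k|]; first exact: sqr_ge0.
    apply: le_trans (bessel hip oe _ _) _; first by rewrite iota_uniq.
    by rewrite expr_le1 ?hnorm_ge0// bessel_family_le1.
  rewrite exchange_big /=; apply: ler_sum => k _; rewrite -mulr_suml.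
  rewrite -[leRHS]mul1r ler_wpM2r ?powR_ge0//.
  apply: (@le_trans _ _ (N (e k) ^+ 2)).
    under eq_bigr => i _ do rewrite (ipC hip) nc_conj.
    exact: bf.
  have [/(ortho_in oe) ->|/(ortho_out hip oe) ->] := boolP (D k).
    by rewrite expr1n.
  by rewrite hnorm0// expr0n.
(* The slope [K i] belongs to the limit value [N (T (f i))], so it does not depend on [n]. *)
have /choice[K KP] : forall i, exists K, 0 <= K /\ forall b, 0 <= b ->
    N (T (f i)) `^ p <= b `^ p + K * (N (T (f i)) - b).
  by move=> i; have [K K0 KP] := powR_lower_tangent (hnorm_ge0 ip (T (f i))) p1; exists K.
have cv : (fun n => L + \sum_(i <- s) K i * N (T (P n (f i)) - T (f i))) @ \oo --> L.
  rewrite -[X in _ --> X]addr0; apply: cvgD; first exact: cvg_cst.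
  rewrite [X in _ --> X](_ : 0 = \sum_(i <- s) 0); last by rewrite big1.
  apply: cvg_big => [|i _]; first exact: add_continuous.
  by rewrite -(mulr0 (K i)); apply: cvgMr; exact: diag_partial_cvg.
apply: (cvgr_to_ge cv); near=> n.
apply: (@le_trans _ _ (\sum_(i <- s) (N (T (P n (f i))) `^ p + K i * N (T (P n (f i)) - T (f i))))).
  apply: ler_sum => i _; have [K0 /(_ _ (hnorm_ge0 ip (T (P n (f i)))))] := KP i.
  move=> /le_trans; apply; rewrite lerD2l ler_wpM2l// [leRHS]hdistC//.
  exact: hnorm_sub_ge.
by rewrite big_split /= lerD2r.
Unshelve. all: by end_near. Qed.

End Diagonal.

Section FromEigenvalues.
Variables (S : H -> H) (lam : nat -> R) (e : nat -> H).
Hypothesis cT : compact_op ip T.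
Hypothesis sqS : is_pos_sqrt ip (fun x => Ts (T x)) S.
Hypothesis eigS : pos_eigen_mult ip S lam e.

Local Notation D := (fun n => 0 < lam n).
Local Notation e' := (fun n => if 0 < lam n then e n else 0).

(** The vectors [e n] with [lam n <= 0] are unconstrained by [pos_eigen_mult], hence their
    replacement by 0 in [e']. *)
Lemma eigen_orthosystem : orthosystem ip D e'.
Proof.
move=> n m /=; have [_ oe _] := eigS.
have [Dn|Dn] := boolP (0 < lam n); last by rewrite ip0l// andbF.
have [Dm|Dm] := boolP (0 < lam m); last first.
  by rewrite ip0r//; case: eqP => // nm; rewrite -nm Dn in Dm.
by rewrite oe// andbT; case: eqP.
Qed.

Lemma eigen_S n : S (e' n) = ((lam n)%:C)%C *: e' n.
Proof.
have [linS _ _ _] := sqS; have [eS _ _] := eigS.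
by case: ifP => [/eS //|_]; rewrite (op_zero linS) scaler0.
Qed.

Lemma eigen_gram n : Ts (T (e' n)) = ((lam n ^+ 2)%:C)%C *: e' n.
Proof.
have [linS _ _ SS] := sqS.
by rewrite -SS /= eigen_S (op_scale linS) eigen_S scalerA -rmorphM -expr2.
Qed.

(* On the complement of the listed eigenvectors, an eigenvector z of [S^2] for
   s^2 would give the eigenvector (S + s) z of S. *)
Lemma eigen_kernel x : (forall n, ip x (e' n) = 0) -> T x = 0.
Proof.
have [linS aS pS SS] := sqS; have [_ _ spanS] := eigS.
move=> xe; apply: contrapT => Tx0.
have stab y : (forall v, range e' v -> ip y v = 0) ->
    forall v, range e' v -> ip (Ts (T y)) v = 0.
  move=> yE _ [n _ <-]; rewrite (gram_selfadjoint hip adj) eigen_gram ipZr// yE ?mulr0//.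
have [|z [s [zE z0 s0 Az]]] := compact_eigenvector hip linT M0 bdT adj cT stab.
  by exists x; split=> // _ [n _ <-].
pose w := S z + (s%:C)%C *: z.
have Sw : S w = (s%:C)%C *: w.
  rewrite /w (op_add linS) (op_scale linS) SS Az scalerDr scalerA -rmorphM -expr2.
  by rewrite addrC.
have we n : ip w (e' n) = 0.
  have zn : ip z (e' n) = 0 by apply: zE; exists n.
  by rewrite /w ipDl// ipZl// aS eigen_S ipZr// zn !mulr0 addr0.
(* Only indices with [lam n = s > 0] occur here; there [e' n] is [e n], so [we] kills every
   coefficient. *)
have [m wE] := spanS s w s0 Sw.
have w0 : w = 0.
  rewrite wE big1// => n /eqP lamn; have := we n.
  by rewrite /= lamn s0 => ->; rewrite scale0r.
(* On the other hand [<w, z> = <S z, z> + s |z|^2] has positive real part. *)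
have : ip w z = 0 by rewrite w0 ip0l.
move=> /(congr1 (@complex.Re R)); rewrite /w ipDl// ipZl// ip_self// -rmorphM raddfD /=.
have [_ Sz] := pS z; have : 0 < s * N z ^+ 2 by rewrite mulr_gt0// exprn_gt0// (hnorm_gt0 hip).
lra.
Qed.

End FromEigenvalues.
End SchattenBound.

(** * The upper estimate for Schatten operators; bases and frames as Bessel families *)

Section OperatorBound.
Variables (R : realType) (H : lmodType R[i]) (ip : H -> H -> R[i]).
Hypothesis hH : separable_hilbert ip.
Local Notation N := (hnorm ip).

Lemma bounded_linear_ge0 (T : H -> H) : bounded_linear ip T ->
  linear T /\ exists2 M : R, 0 <= M & forall x, N (T x) <= M * N x.
Proof.
move=> [linT [M MP]]; split=> //; exists `|M| => // x.
by rewrite (le_trans (MP x))// ler_wpM2r ?hnorm_ge0 ?ler_norm.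
Qed.

Lemma schatten_bessel_bound (p : R) (T : H -> H) : 2 <= p -> bounded_linear ip T ->
  schatten ip p T -> exists C : R, 0 < C /\
    forall (I : choiceType) (f : I -> H), bessel_family ip f ->
      (\esum_(i in [set: I]) ((N (T (f i))) `^ p)%R%:E <= C%:E)%E.
Proof.
move=> p2 /bounded_linear_ge0[linT [M M0 bdT]].
have [hip hcomplete _] := hH.
move=> [cT [Ts [S [lam [e [adj sqS eigS sumL]]]]]].
set es := \esum_(n in _) _ in sumL.
have es0 : (0 <= es)%E by apply: esum_ge0 => n _; rewrite lee_fin powR_ge0.
(* The constant below is [L + 1], which is positive even when [L = 0]. *)
have esE : es = (fine es)%:E by rewrite fineK// ge0_fin_numE.
pose L := fine es; exists (L + 1); split; first by rewrite ltr_wpDl ?fine_ge0.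
move=> I f bf; apply: esum_le_seq => s us _.
(* At indices that list no eigenvalue [lam] may be negative; [lam'] is 0 there, so these indices add
   nothing to the sum. *)
pose lam' n := if 0 < lam n then lam n else 0.
have lam'0 n : 0 <= lam' n by rewrite /lam'; case: ifP => // /ltW.
apply: (@le_trans _ _ L); last by rewrite lerDl.
refine (diag_bessel_bound hip hcomplete linT bdT adj
  (eigen_orthosystem hip eigS) (lam := lam') _ lam'0 _ p2 _ bf us).
- move=> n; rewrite (eigen_gram sqS eigS) /lam'; case: ifP => // _.
  by rewrite !scaler0.
- exact: (eigen_kernel hip linT M0 bdT adj cT sqS eigS).
- move=> n; have -> : \sum_(0 <= k < n) lam' k `^ p =
      \sum_(k <- [seq k <- index_iota 0 n | 0 < lam k]) lam k `^ p.
    rewrite big_filter [RHS]big_mkcond; apply: eq_bigr => k _; rewrite /lam'.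
    by case: ifP => // _; rewrite powR0// gt_eqF//; lra.
  rewrite -lee_fin -esE; apply: (@esum_ge_seq _ _ [set k | 0 < lam k]) => //.
    by rewrite filter_uniq// iota_uniq.
  by move=> k; rewrite mem_filter => /andP[].
Qed.

Lemma orthonormal_bessel (I : eqType) (e : I -> H) :
  (forall i j, ip (e i) (e j) = (if i == j then 1 else 0)) -> bessel_family ip e.
Proof.
move=> oe x s us; have [hip _ _] := hH.
apply: (@bessel _ _ _ hip _ predT) => // i j; rewrite oe andbT; by case: eqP.
Qed.

(** As the upper frame bound is an infimum, an admissible constant slightly above it is used, and
    the resulting error [eps] is arbitrary. *)
Lemma frame_bessel (I : countType) (f : I -> H) :
  is_frame ip f -> upper_frame_bound ip f <= 1 -> bessel_family ip f.
Proof.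
move=> [C2 C2P] ub1 x s us.
have hinf : has_inf [set C | admissible_upper_bound ip f C].
  split; first by exists C2.
  by exists 0 => C [C1 [C10 C1C _]]; rewrite (le_trans (ltW C10)).
apply/ler_addgt0Pl => eps e0.
(* This excess, multiplied by [N x ^+ 2], is at most [eps]. *)
have d0 : 0 < eps / (N x ^+ 2 + 1) by rewrite divr_gt0// ltr_wpDl ?sqr_ge0.
have [C [C1 [_ _ /(_ x) [_ CP]]] Clt] := inf_adherent d0 hinf.
have := esum_ge_seq CP us (fun i _ => Logic.I); rewrite lee_fin => /le_trans; apply.
have : C <= eps / (N x ^+ 2 + 1) + 1.
  by move: Clt ub1; rewrite /upper_frame_bound; lra.
move=> /(ler_wpM2r (sqr_ge0 (N x))) /le_trans; apply.
rewrite mulrDl mul1r lerD2r -mulrA ler_piMr ?(ltW e0)// mulrC ler_pdivrMr ?mul1r ?lerDl//.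
by rewrite ltr_wpDl ?sqr_ge0.
Qed.

(** Both constants are 1: the upper inequality is Bessel's, the lower one Parseval's. The countable
    index type is carried to [nat] by [pickle_inv]; numbers that encode no index get the vector
    0. *)
Lemma basis_frame (I : countType) (e : I -> H) : orthonormal_basis ip e ->
  is_frame ip e /\ upper_frame_bound ip e <= 1.
Proof.
move=> [oe eC]; have [hip hcomplete _] := hH.
have adm : admissible_upper_bound ip e 1.
  exists 1; split=> // x; rewrite mul1r; split; last first.
    by apply: esum_le_seq => s us _; apply: orthonormal_bessel.
  pose g (n : nat) := if @pickle_inv I n is Some i then e i else 0.
  have og : orthosystem ip [pred n | @pickle_inv I n] g.
    move=> n m; rewrite /g /=.
    case En : (@pickle_inv I n) => [i|]; last by rewrite ip0l// andbF.
    case Em : (@pickle_inv I m) => [j|]; last first.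
      by rewrite ip0r//; case: eqP => // nm; rewrite -nm En in Em.
    rewrite oe andbT; have [ij|ij] := eqVneq i j; have [nm|nm] := eqVneq n m => //.
    - have := @pickle_invK I n; have := @pickle_invK I m; rewrite En Em /= ij.
      by move=> jm jn; move: nm; rewrite -jm -jn eqxx.
    - by move: En; rewrite nm Em => -[] ji; rewrite ji eqxx in ij.
  have gC y : (forall n, ip y (g n) = 0) -> y = 0.
    by move=> yg; apply: eC => i; have := yg (pickle i); rewrite /g pickleK_inv.
  have cvx := parseval hip hcomplete og x gC.
  pose r n := N (\sum_(0 <= k < n) ip x (g k) *: g k - x).
  have cv2 : (fun n => r n * r n) @ \oo --> (0 : R).
    by rewrite -(mulr0 0); apply: cvgM.
  have fin n : ((N x ^+ 2 - N (\sum_(0 <= k < n) ip x (g k) *: g k - x) ^+ 2)%:E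
      <= frame_sum ip e x)%E.
    rewrite hdistC// (bessel_eq hip og) ?iota_uniq//.
    rewrite opprB addrCA subrr addr0.
    (* Decoding the numbers below [n] yields a duplicate-free list of indices with the same sum. *)
    have -> : \sum_(0 <= k < n) nc (ip x (g k)) ^+ 2 =
        \sum_(i <- pmap (@pickle_inv I) (index_iota 0 n)) nc (ip x (e i)) ^+ 2.
      elim: (index_iota 0 n) => [|k s IH]; rewrite ?big_nil// big_cons /= IH /g.
      case: (@pickle_inv I k) => [i|]; rewrite ?big_cons//= ip0r//.
      by rewrite ComplexField.Normc.normc0 expr0n add0r.
    apply: (@esum_ge_seq _ _ setT (fun i => nc (ip x (e i)) ^+ 2)) => //.
    apply: (@pmap_uniq _ _ _ pickle); last exact: iota_uniq.
    exact: pickle_invK.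
  apply/lee_addgt0Pr => eps e0.
  have /cvgrPdist_lt/(_ _ e0)/filter_ex[n] := cv2.
  rewrite sub0r normrN ger0_norm ?mulr_ge0 ?hnorm_ge0//= => h.
  apply: le_trans (leeD2r _ (fin n)); rewrite -EFinD lee_fin.
  by move: h; rewrite /r -expr2; lra.
split; first by exists 1.
apply: inf_lbound => //; exists 0 => C [C1 [C10 C1C _]].
by rewrite (le_trans (ltW C10)).
Qed.

End OperatorBound.

(** * Maximal orthonormal sets and extension to bases *)

Section OrthonormalSets.
Variables (R : realType) (H : lmodType R[i]) (ip : H -> H -> R[i]).
Hypothesis hH : separable_hilbert ip.
Local Notation N := (hnorm ip).
Let hip : inner_product_axioms ip. Proof. by case: hH. Qed.

Definition orthonormal_set (E : set H) : Prop :=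
  forall x y, E x -> E y -> ip x y = (x == y)%:R.

(** Zorn's lemma for the sets [E] to be added to [E0]; in this form the union of the empty chain
    also satisfies [P]. *)
Lemma maximal_orthonormal (Q E0 : set H) : E0 `<=` Q -> orthonormal_set E0 ->
  exists E, [/\ E0 `<=` E, E `<=` Q, orthonormal_set E &
    forall x, Q x -> N x = 1 -> ~ (forall y, E y -> ip x y = 0)].
Proof.
move=> E0Q oE0.
pose P (E : set H) := E `<=` Q /\ orthonormal_set (E0 `|` E).
have [F FP totF|A [[AQ oA] maxA]] := @Zorn_bigcup _ P.
  split; first by move=> x [X FX Xx]; exact: (FP X FX).1.
  move=> x y [E0x|[X FX Xx]] [E0y|[Y FY Yy]].
  - exact: oE0.
  - by apply: (FP Y FY).2; [left|right].
  - by apply: (FP X FX).2; [right|left].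
  - have [XY|YX] := totF X Y FX FY.
      by apply: (FP Y FY).2; right => //; exact: XY.
    by apply: (FP X FX).2; right => //; exact: YX.
exists (E0 `|` A); split; [exact: subsetUl|by move=> x [/E0Q|/AQ]|exact: oA|].
move=> x Qx x1 xE.
have xx : ip x x = 1 by rewrite ip_self// x1 expr1n.
have nx y : (E0 `|` A) y -> x != y.
  move=> Ey; apply/eqP => xy; have := xE y Ey; rewrite -xy xx.
  by move/eqP; rewrite oner_eq0.
apply: (maxA (A `|` [set x])).
  split; first exact: subsetUl.
  move=> /(_ x) xA; have Ax : A x by apply: xA; right.
  by have /eqP := nx x (or_intror Ax).
split; first by move=> y [/AQ|->].
have oE y : (E0 `|` A) y -> ip y x = (y == x)%:R.
  by move=> Ey; rewrite (ipC hip) xE// conjc0 eq_sym (negbTE (nx _ Ey)).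
move=> y z; rewrite setUA => -[Ey|->] [Ez|->].
- exact: oA.
- exact: oE.
- by rewrite (xE _ Ez) (negbTE (nx _ Ez)).
- by rewrite xx eqxx.
Qed.

(** Distinct orthonormal vectors have distance [sqrt 2 > 1], so no term of the dense sequence is
    within 1/2 of two of them; the index [g x] of a nearby term numbers [x]. *)
Lemma orthonormal_enum (E : set H) : orthonormal_set E ->
  exists (D : pred nat) (e : nat -> H), [/\ orthosystem ip D e,
    forall n, D n -> E (e n) & forall x, E x -> exists2 n, D n & e n = x].
Proof.
move=> oE; have [_ _ [d dP]] := hH.
have /choice[g gP] : forall x, exists n, N (x - d n) < 2^-1.
  by move=> x; apply: dP; rewrite invr_gt0.
have ginj x y : E x -> E y -> g x = g y -> x = y.
  move=> Ex Ey gxy; apply/eqP/negPn/negP => nxy.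
  have : N (x - y) < 1.
    apply: le_lt_trans (hdistD hip _ (d (g x)) _) _; rewrite [ltRHS]splitr mul1r.
    by apply: ltrD; [exact: gP|rewrite hdistC// gxy; exact: gP].
  have n1 z : E z -> N z ^+ 2 = 1.
    by move=> Ez; apply: complexI; rewrite -ip_self// oE// eqxx.
  rewrite -ltr_sqr ?nnegrE ?hnorm_ge0// hnorm_sqrB// oE// (negbTE nxy) !n1//=.
  by rewrite expr1n mulr0 subr0; lra.
pose D n := `[< exists x, E x /\ g x = n >].
have /choice[e eP] : forall n, exists v, if D n then E v /\ g v = n else v = 0.
  move=> n; rewrite /D; case: asboolP => [[x [Ex gx]]|_]; last by exists 0.
  by exists x.
have De n : D n -> E (e n) /\ g (e n) = n by move=> Dn; have := eP n; rewrite Dn.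
have De0 n : ~~ D n -> e n = 0 by move=> /negbTE Dn; have := eP n; rewrite Dn.
exists D, e; split.
- move=> n m; have [Dn|Dn] := boolP (D n); last by rewrite De0// ip0l// andbF.
  have [Dm|Dm] := boolP (D m); last first.
    by rewrite [e m]De0// ip0r//; case: eqP => // nm; rewrite -nm Dn in Dm.
  have [En gn] := De n Dn; have [Em gm] := De m Dm.
  rewrite oE// andbT; congr (nat_of_bool _)%:R; apply/eqP/eqP => [enm|->//].
  by rewrite -gn -gm enm.
- by move=> n /De[].
- move=> x Ex; have Dx : D (g x) by apply/asboolP; exists x.
  exists (g x) => //; have [Ee ge] := De _ Dx; exact: ginj.
Qed.

Lemma maximal_complete (E : set H) :
  (forall x, N x = 1 -> ~ (forall y, E y -> ip x y = 0)) ->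
  forall x, (forall y, E y -> ip x y = 0) -> x = 0.
Proof.
move=> maxE x xE; apply: contrapT => /(hnorm_normalized hip) /maxE; apply => y Ey.
by rewrite ipZl// xE// mulr0.
Qed.

(** The list extends to a maximal orthonormal set, hence to a basis, and its sum is a partial sum of
    the basis sum. *)
Lemma basis_bound_finite (p C : R) (T : H -> H) :
  (forall (I : countType) (e : I -> H), orthonormal_basis ip e ->
     (\esum_(i in [set: I]) ((N (T (e i))) `^ p)%R%:E <= C%:E)%E) ->
  forall s : seq H, uniq s -> orthonormal_seq ip s -> \sum_(x <- s) N (T x) `^ p <= C.
Proof.
move=> hC s us os.
have [|E [sE _ oE maxE]] := @maximal_orthonormal setT [set` s] (fun _ _ => Logic.I).
  by move=> x y xs ys; apply: os.
have [D [e [oe De eE]]] := orthonormal_enum oE.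
(* The subtype removes the indices at which [e] is 0. *)
pose f (i : {n | D n}) := e (val i).
have bf : orthonormal_basis ip f.
  split=> [i j|x xe].
    rewrite oe (valP i) andbT; case: (i =P j) => [->|/eqP ij]; first by rewrite eqxx.
    by rewrite val_eqE (negbTE ij).
  apply: (maximal_complete (E := E)) => [y y1|y /eE[n Dn <-]]; first exact: maxE.
  exact: (xe (Sub n Dn)).
have [t tE] : exists t, s = map f t.
  have : {subset s <= s} by [].
  elim: {1 3}s => [|y s' IH] ss; first by exists [::].
  have [|t ->] := IH; first by move=> z zs; apply: ss; rewrite inE zs orbT.
  have /eE[n Dn <-] : E y by apply: sE => /=; apply: ss; rewrite inE eqxx.
  by exists (Sub n Dn :: t).
rewrite tE big_map -lee_fin.
apply: (@esum_ge_seq _ _ setT (fun i => N (T (f i)) `^ p)) => //; first exact: hC.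
by apply: (@map_uniq _ _ f); rewrite -tE.
Qed.

(** * Compactness from smallness on complements of finite lists *)

Section Compactness.
Variables (T : H -> H) (M : R).
Hypothesis linT : linear T.
Hypothesis M0 : 0 <= M.
Hypothesis bdT : forall x, N (T x) <= M * N x.

(* Orthonormal lists on which [N (T x) >= eps] have bounded length; take one of
   maximal length. *)
Lemma small_complement (p C eps : R) : 0 <= p ->
  (forall s : seq H, uniq s -> orthonormal_seq ip s -> \sum_(x <- s) N (T x) `^ p <= C) ->
  0 < eps -> exists s : seq H, [/\ uniq s, orthonormal_seq ip s &
    forall x, {in s, forall y, ip x y = 0} -> N (T x) <= eps * N x].
Proof.
move=> p0 hC e0.
pose G n := `[< exists s : seq H, [/\ uniq s, orthonormal_seq ip s,
  {in s, forall x, eps <= N (T x)} & size s = n] >].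
have ep0 : 0 < eps `^ p by rewrite powR_gt0.
have C0 : 0 <= C by have := hC [::] isT (fun _ _ => ltac:(done)); rewrite big_nil.
have G0 : exists n, G n by exists 0%N; apply/asboolP; exists [::].
(* Each vector of the list contributes at least the [p]-th power of [eps] to a sum bounded by
   [C]. *)
have Gub n : G n -> (n <= Num.bound (C / eps `^ p))%N.
  move=> /asboolP[s [us os sT sn]]; rewrite -(ler_nat R).
  apply: le_trans (ltW (archi_boundP _)); last by rewrite divr_ge0// ltW.
  rewrite ler_pdivlMr//; apply: le_trans (hC s us os).
  have -> : n%:R * eps `^ p = \sum_(x <- s) eps `^ p.
    by rewrite big_const_seq count_predT iter_addr_0 sn mulr_natl.
  rewrite big_seq [leRHS]big_seq.
  apply: ler_sum => x xs; apply: ge0_ler_powR => //; rewrite ?nnegrE ?(ltW e0) ?hnorm_ge0//.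
  exact: sT.
case: (ex_maxnP G0 Gub) => n /asboolP[s [us os sT sn]] maxn.
exists s; split => // x xs.
have [->|/eqP x0] := eqVneq x 0; first by rewrite op_zero// hnorm0// mulr0.
pose x' := (((N x)^-1)%:C)%C *: x.
have x'1 : N x' = 1 by exact: hnorm_normalized.
have x's y : y \in s -> ip x' y = 0 by move=> /xs xy; rewrite /x' ipZl// xy mulr0.
have x'x' : ip x' x' = 1 by rewrite ip_self// x'1 expr1n.
have nx' y : y \in s -> x' != y.
  move=> ys; apply/eqP => xy; have := x's y ys; rewrite -xy x'x' => /eqP.
  by rewrite oner_eq0.
have [small|big] := ltP (N (T x')) eps.
  have : N (T x') <= eps by exact: ltW.
  rewrite /x' op_scale// hnormZ// nc_real ger0_norm ?invr_ge0 ?hnorm_ge0//.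
  by rewrite mulrC ler_pdivrMr// (hnorm_gt0 hip).
have : G n.+1.
  apply/asboolP; exists (x' :: s); split; rewrite /= ?sn//.
  - by rewrite us andbT; apply/negP => /nx'; rewrite eqxx.
  - move=> y z; rewrite !inE => /predU1P[->|ys] /predU1P[->|zs].
    + by rewrite x'x' eqxx.
    + by rewrite x's// (negbTE (nx' _ zs)).
    + by rewrite (ipC hip) x's// conjc0 eq_sym (negbTE (nx' _ ys)).
    + exact: os.
  - by move=> y; rewrite inE => /predU1P[->//|/sT].
by move=> /maxn; rewrite ltnn.
Qed.

(** The image of [U] lives on a compact interval, so it clusters at some [r]; for an ultrafilter a
    cluster point is a limit. *)
Lemma ultra_bounded_cvg (U : set_system nat) (f : nat -> R) (B : R) : UltraFilter U ->
  (forall n, `|f n| <= B) ->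
  exists r, forall eps : R, 0 < eps -> U [set n | `|r - f n| < eps].
Proof.
move=> UU fB.
have UB : (f @ U) [set` `[- B, B]].
  apply: (@filterS _ U _ setT); last exact: filterT.
  by move=> n _; rewrite /= in_itv /= -ler_norml.
have [r [_ cr]] := @segment_compact R (- B) B (f @ U) _ UB.
exists r => eps e0.
have [//|Uc] := in_ultra_setVsetC [set n | `|r - f n| < eps] UU.
have [y [/= h1 h2]] := cr (~` (ball r eps)) (ball r eps) Uc (nbhsx_ballx r eps e0).
by [].
Qed.

(** A bounded sequence is weakly Cauchy along [U]; real and imaginary parts cost [eps / 2] each. *)
Lemma ultra_coef_cauchy (U : set_system nat) (u : nat -> H) (B : R) (y : H) :
  UltraFilter U -> (forall n, N (u n) <= B) -> forall eps : R, 0 < eps ->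
  exists A, U A /\ forall m n, A m -> A n -> nc (ip (u m) y - ip (u n) y) < eps.
Proof.
move=> UU uB eps e0.
have e4 : 0 < eps / 4 by rewrite divr_gt0.
have bnd n : nc (ip (u n) y) <= B * N y.
  by apply: le_trans (cauchy_schwarz hip _ _) _; rewrite ler_wpM2r ?hnorm_ge0.
have [r1 /(_ _ e4) A1] := @ultra_bounded_cvg U (fun n => complex.Re (ip (u n) y)) _ UU
  (fun n => le_trans (Re_le_nc _) (bnd n)).
have [r2 /(_ _ e4) A2] := @ultra_bounded_cvg U (fun n => complex.Im (ip (u n) y)) _ UU
  (fun n => le_trans (Im_le_nc _) (bnd n)).
exists ([set n | `|r1 - complex.Re (ip (u n) y)| < eps / 4] `&`
        [set n | `|r2 - complex.Im (ip (u n) y)| < eps / 4]).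
split; first exact: filterI.
move=> m n [/= m1 m2] [/= n1 n2].
apply: le_lt_trans (nc_le_ReIm _) _; rewrite !raddfB /=.
have g1 : `|complex.Re (ip (u m) y) - complex.Re (ip (u n) y)| < eps / 4 + eps / 4.
  by apply: le_lt_trans (ler_distD r1 _ _) _; rewrite ltrD// distrC.
have g2 : `|complex.Im (ip (u m) y) - complex.Im (ip (u n) y)| < eps / 4 + eps / 4.
  by apply: le_lt_trans (ler_distD r2 _ _) _; rewrite ltrD// distrC.
lra.
Qed.

(** For orthonormal [s] this sum dominates the norm of [T] at the projection of [u m - u n] onto the
    span of [s]. *)
Lemma ultra_sum_cauchy (U : set_system nat) (u : nat -> H) (B : R) (s : seq H) :
  UltraFilter U -> (forall n, N (u n) <= B) -> forall eps : R, 0 < eps ->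
  exists A, U A /\ forall m n, A m -> A n ->
    \sum_(y <- s) nc (ip (u m - u n) y) * N (T y) < eps.
Proof.
move=> UU uB; elim: s => [|y s IH] eps e0.
  by exists setT; split; [exact: filterT|move=> m n _ _; rewrite big_nil].
have e2 : 0 < eps / 2 by rewrite divr_gt0.
have K0 : 0 < N (T y) + 1 by rewrite ltr_wpDl ?hnorm_ge0.
have [A [UA AP]] := IH _ e2.
have [A' [UA' AP']] := ultra_coef_cauchy y UU uB (divr_gt0 e2 K0).
exists (A `&` A'); split; first exact: filterI.
move=> m n [Am A'm] [An A'n]; rewrite big_cons [eps]splitr ltrD//; last exact: AP.
apply: (@le_lt_trans _ _ (nc (ip (u m - u n) y) * (N (T y) + 1))).
  by rewrite ler_wpM2l ?nc_ge0// lerDl.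
by rewrite -ltr_pdivlMr// ipBl//; apply: AP'.
Qed.

(** The vector [u m - u n] splits into its projection [P] onto the span of [s], where weak
    convergence along an ultrafilter makes [T] small, and a remainder of norm at most [2 * B], where
    the hypothesis does. One ultrafilter serves all lists [s]; a subsequence is extracted at the
    end. *)
Lemma small_complement_compact :
  (forall eps : R, 0 < eps -> exists s : seq H, [/\ uniq s, orthonormal_seq ip s &
    forall x, {in s, forall y, ip x y = 0} -> N (T x) <= eps * N x]) ->
  compact_op ip T.
Proof.
move=> small u [B0 uB0].
have hcomplete : forall u : nat -> H, hcauchy ip u -> exists l, hconverges_to ip u l.
  by case: hH.
pose B : R := `|B0| + 1.
have B_gt0 : 0 < B by rewrite ltr_wpDl.
have uB n : N (u n) <= B.
  by apply: le_trans (uB0 n) _; rewrite (le_trans (ler_norm _))// lerDl.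
have [U [UU ooU]] := ultraFilterLemma (eventually_filter).
have cauchyU (eps : R) : 0 < eps -> exists A, U A /\ forall m n, A m -> A n ->
    N (T (u m) - T (u n)) < eps.
  move=> e0; have e2 : 0 < eps / 2 by rewrite divr_gt0.
  have [s [us os sP]] := small _ (divr_gt0 e2 (mulr_gt0 (ltr0n R 2) B_gt0)).
  have [A [UA AP]] := ultra_sum_cauchy s UU uB e2.
  exists A; split=> // m n Am An; rewrite -op_sub//.
  set x := u m - u n.
  pose P := \sum_(y <- s) ip x y *: y.
  have oe := orthosystem_seq hip os.
  pose e y : H := if y \in s then y else 0.
  have PE : P = \sum_(y <- s) ip x (e y) *: e y.
    by rewrite /P big_seq [RHS]big_seq; apply: eq_bigr => y ys; rewrite /e ys.
  have xP : {in s, forall y, ip (x - P) y = 0}.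
    move=> y ys; have := ip_comb hip oe (fun y => ip x (e y)) y us.
    rewrite -PE ys /= /e ys => Py; rewrite ipBl// Py subrr//.
  have NxP : N (x - P) <= 2 * B.
    apply: (@le_trans _ _ (N x)).
      rewrite -ler_sqr ?nnegrE ?hnorm_ge0// PE (bessel_eq hip oe)//.
      by rewrite gerBl sumr_ge0// => y _; rewrite sqr_ge0.
    by have := le_hnormB hip (u m) (u n); have := uB m; have := uB n; rewrite -/x; lra.
  rewrite -[x](subrK P) op_add//; apply: le_lt_trans (le_hnormD hip _ _) _.
  rewrite [eps]splitr addrC ltr_leD//.
    apply: le_lt_trans (AP m n Am An); rewrite op_sum//.
    apply: le_trans (hnorm_sum hip _ _) _; apply: ler_sum => y _.
    by rewrite op_scale// hnormZ.
  apply: le_trans (sP _ xP) _.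
  have := ler_wpM2l (ltW (divr_gt0 e2 (mulr_gt0 (ltr0n R 2) B_gt0))) NxP.
  by move=> /le_trans; apply; rewrite divfK// gt_eqF// mulr_gt0.
have /choice[A AP] : forall k : nat, exists A, U A /\ forall m n, A m -> A n ->
    N (T (u m) - T (u n)) < k.+1%:R^-1.
  by move=> k; apply: cauchyU; rewrite invr_gt0.
have UA k : U [set n | forall j, (j <= k)%N -> A j n].
  elim: k => [|k IH].
    by apply: filterS (AP 0%N).1 => n An j; rewrite leqn0 => /eqP ->.
  apply: filterS (filterI IH (AP k.+1).1) => n [h1 h2] j.
  by rewrite leq_eqVlt => /predU1P[->//|]; rewrite ltnS => /h1.
have /choice[nxt nxtP] : forall km : nat * nat, exists n,
    (km.2 < n)%N /\ forall j, (j <= km.1)%N -> A j n.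
  move=> [k m] /=; have Um : U [set n | (m < n)%N] by apply: ooU; exists m.+1.
  have [n [h1 h2]] := filter_ex (filterI Um (UA k)).
  by exists n.
(* The index [phi n] lies in [A 0], ..., [A n] and exceeds the previous one, which is possible
   because [U] contains every tail. *)
pose phi := fix phi n := if n is k.+1 then nxt (k.+1, phi k) else nxt (0%N, 0%N).
have phiA k j : (j <= k)%N -> A j (phi k).
  by case: k => [|k] jk /=; [apply: (nxtP (0, 0)%N).2|apply: (nxtP (k.+1, phi k)).2].
exists phi; split; first by move=> n; exact: (nxtP (n.+1, phi n)).1.
apply: hcomplete => eps e0.
have [j _ jP] := near_infty_natSinv_lt (PosNum e0).
exists j => m n jm jn; apply: lt_trans (jP j (leqnn j)).
by apply: (AP j).2; apply: phiA.
Qed.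

End Compactness.
End OrthonormalSets.

(** * Existence of the adjoint and of an eigensystem *)

Section Spectral.
Variables (R : realType) (H : lmodType R[i]) (ip : H -> H -> R[i]).
Hypothesis hH : separable_hilbert ip.
Local Notation N := (hnorm ip).
Let hip : inner_product_axioms ip. Proof. by case: hH. Qed.
Let hcomplete : forall u : nat -> H, hcauchy ip u -> exists l, hconverges_to ip u l.
Proof. by case: hH. Qed.
Variables (T : H -> H) (M : R).
Hypothesis linT : linear T.
Hypothesis M0 : 0 <= M.
Hypothesis bdT : forall x, N (T x) <= M * N x.

Lemma exists_complete_orthosystem : exists (D : pred nat) (e : nat -> H),
  orthosystem ip D e /\ forall x, (forall n, ip x (e n) = 0) -> x = 0.
Proof.
have [|E [_ _ oE maxE]] := @maximal_orthonormal _ _ _ hH setT set0 (fun _ _ => Logic.I).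
  by move=> x y [].
have [D [e [oe De eE]]] := orthonormal_enum hH oE.
exists D, e; split=> // x xe; apply: (maximal_complete hH (E := E)).
  by move=> y; exact: maxE.
by move=> y /eE[n _ <-].
Qed.

(* Riesz: [Ts y] is assembled from its coefficients [ip y (T (e k))] on an
   orthonormal basis [e]. *)
Lemma exists_adjoint : exists Ts, is_adjoint ip T Ts.
Proof.
have [D [e [oe eC]]] := exists_complete_orthosystem.
suff h y : exists v, forall x, ip (T x) y = ip x v.
  by have [Ts TsP] := choice h; exists Ts => x y; apply: TsP.
pose c k := ip y (T (e k)).
have cK n : \sum_(0 <= k < n) nc (c k) ^+ 2 <= (N y * M) ^+ 2.
  (* Pairing [y] with [T w] gives [|w|^2 <= |y| M |w|], which bounds the coefficient sum [|w|^2]. *)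
  pose w := \sum_(0 <= k < n) c k *: e k.
  have cout k : ~~ D k -> c k = 0.
    by move=> /(ortho_out hip oe) ek; rewrite /c ek op_zero// ip0r.
  have wE : N w ^+ 2 = \sum_(0 <= k < n) nc (c k) ^+ 2.
    rewrite (hnorm_comb hip oe) ?iota_uniq// big_mkcond; apply: eq_bigr => k _.
    by case: ifPn => // /cout ->; rewrite ComplexField.Normc.normc0 expr0n.
  have yTw : ip y (T w) = ((N w ^+ 2)%:C)%C.
    rewrite wE op_sum// ip_sumr// rmorph_sum; apply: eq_bigr => k _ /=.
    by rewrite op_scale// ipZr// mulrC mulc_conj.
  have : N w ^+ 2 <= N y * (M * N w).
    have := cauchy_schwarz hip y (T w); rewrite yTw nc_real ger0_norm ?sqr_ge0//.
    by move=> /le_trans; apply; rewrite ler_wpM2l ?hnorm_ge0.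
  rewrite -wE ler_sqr ?nnegrE ?mulr_ge0 ?hnorm_ge0// mulrA expr2.
  have [->|w0] := eqVneq (N w) 0; first by rewrite mulr_ge0 ?hnorm_ge0.
  by rewrite ler_pM2r// lt_neqAle eq_sym w0 hnorm_ge0.
have [v [_ vE _]] := ortho_series hip hcomplete oe cK.
exists v => x.
have xcv := parseval hip hcomplete oe x eC.
have Txcv := op_cvg linT bdT xcv.
apply: (ip_lim_eq hip Txcv xcv); near=> n.
rewrite op_sum// !ip_suml//; apply: eq_bigr => k _.
rewrite op_scale// !ipZl//; have [Dk|/(ortho_out hip oe) ->] := boolP (D k).
  by rewrite [ip (e k) v](ipC hip) vE// /c -(ipC hip).
by rewrite ip0r// !mul0r.
Unshelve. all: by end_near. Qed.

Variable Ts : H -> H.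
Hypothesis adj : is_adjoint ip T Ts.
Hypothesis cT : compact_op ip T.

(** A maximal orthonormal set of eigenvectors of [Ts \o T] with positive eigenvalues works: were [T]
    nonzero somewhere on its complement, [compact_eigenvector] would supply one more. *)
Lemma exists_eigensystem : exists (D : pred nat) (e : nat -> H),
  [/\ orthosystem ip D e,
      forall n, Ts (T (e n)) = ((N (T (e n)) ^+ 2)%:C)%C *: e n,
      forall n, D n = (0 < N (T (e n))) &
      forall x, (forall n, ip x (e n) = 0) -> T x = 0].
Proof.
have linTs := adjoint_linear hip adj.
pose Q := [set x | exists a : R, 0 < a /\ Ts (T x) = (a%:C)%C *: x].
have [//||E [_ EQ oE maxE]] := @maximal_orthonormal _ _ _ hH Q set0; first by move=> x y [].
have [D [e [oe De eE]]] := orthonormal_enum hH oE.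
have eout n : ~~ D n -> e n = 0 by exact: (ortho_out hip oe).
have Aa n : D n -> exists a : R, [/\ 0 < a, Ts (T (e n)) = (a%:C)%C *: e n & N (T (e n)) ^+ 2 = a].
  move=> Dn; have [a [a0 Ta]] := EQ _ (De n Dn); exists a; split=> //.
  apply: complexI; rewrite -(gram_self hip adj) Ta ipZl// oe eqxx Dn mulr1//.
have Ae n : Ts (T (e n)) = ((N (T (e n)) ^+ 2)%:C)%C *: e n.
  have [/Aa[a [_ Ta ->]]//|/eout ->] := boolP (D n).
  by rewrite op_zero// op_zero// scaler0.
exists D, e; split => //.
  move=> n; have [/Aa[a [a0 _ Na]]|/eout ->] := boolP (D n); last first.
    by rewrite op_zero// hnorm0// ltxx.
  rewrite lt_neqAle hnorm_ge0 andbT eq_sym; apply/esym/eqP => N0.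
  by move: a0; rewrite -Na N0 expr0n ltxx.
move=> x xe; apply: contrapT => Tx0.
have stab y : (forall v, range e v -> ip y v = 0) ->
    forall v, range e v -> ip (Ts (T y)) v = 0.
  by move=> yE _ [n _ <-]; rewrite (gram_selfadjoint hip adj) Ae ipZr// yE ?mulr0.
have [|z [s [zE z0 s0 Az]]] := compact_eigenvector hip linT M0 bdT adj cT stab.
  by exists x; split=> // _ [n _ <-].
apply: (maxE ((((N z)^-1)%:C)%C *: z)).
- exists (s ^+ 2); split; first by rewrite exprn_gt0.
  by rewrite op_scale// op_scale// Az !scalerA mulrC.
- exact: hnorm_normalized.
- by move=> y /eE[n _ <-]; rewrite ipZl// zE ?mulr0//; exists n.
Qed.

(** * The square root of [Ts \o T] and its eigenvalues *)

Section SquareRoot.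
Variables (D : pred nat) (e : nat -> H).
Hypothesis oe : orthosystem ip D e.
Hypothesis Ae : forall n, Ts (T (e n)) = ((N (T (e n)) ^+ 2)%:C)%C *: e n.
Hypothesis Dlam : forall n, D n = (0 < N (T (e n))).
Hypothesis kerT : forall x, (forall n, ip x (e n) = 0) -> T x = 0.

Lemma lam_le n : N (T (e n)) <= M.
Proof.
apply: le_trans (bdT _) _; rewrite ler_piMr//.
have [/(ortho_in oe) ->//|/(ortho_out hip oe) ->] := boolP (D n).
by rewrite hnorm0.
Qed.

(** Taking [y = v] shows that [v] is orthogonal to itself; this is the equality test for vectors of
    the closed span. *)
Lemma coef_separation v : (forall n, ip v (e n) = 0) ->
  (forall y, (forall n, ip y (e n) = 0) -> ip v y = 0) -> v = 0.
Proof. by move=> ve vy; apply: (ip_self_eq0 hip); apply: vy. Qed.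

(** Here [S x] is the sum of the series [N (T (e k)) <x, e k> e k]. The last two clauses determine
    it, and identities for [S] follow from them by [coef_separation]. *)
Lemma exists_sqrt : exists S : H -> H, [/\ is_pos_sqrt ip (fun x => Ts (T x)) S,
  forall x n, ip (S x) (e n) = ((N (T (e n)))%:C)%C * ip x (e n) &
  forall x y, (forall n, ip y (e n) = 0) -> ip (S x) y = 0].
Proof.
pose c x k : R[i] := ((N (T (e k)))%:C)%C * ip x (e k).
pose P x n := \sum_(0 <= k < n) c x k *: e k.
have h x : exists v, [/\ hconverges_to ip (P x) v,
    forall n, ip v (e n) = c x n & forall y, (forall n, ip y (e n) = 0) -> ip v y = 0].
  have [n|v [v1 v2 v3]] := @ortho_series _ _ _ hip hcomplete _ _ oe (c x) (M ^+ 2 * N x ^+ 2).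
    apply: (@le_trans _ _ (M ^+ 2 * \sum_(0 <= k < n) nc (ip x (e k)) ^+ 2)).
      rewrite mulr_sumr; apply: ler_sum => k _; rewrite /c ComplexField.Normc.normcM exprMn.
      rewrite nc_real ger0_norm ?hnorm_ge0// ler_wpM2r ?sqr_ge0//.
      by rewrite ler_sqr ?nnegrE ?hnorm_ge0// lam_le.
    by rewrite ler_wpM2l ?sqr_ge0// (bessel hip oe)// iota_uniq.
  exists v; split=> // n; have [/v2//|/(ortho_out hip oe)] := boolP (D n).
  by move=> en; rewrite /c en !(ip0r hip) mulr0.
have [S SP] := choice h.
have Scv x : hconverges_to ip (P x) (S x) by case: (SP x).
have Se x n : ip (S x) (e n) = c x n by case: (SP x).
have Sy x y : (forall n, ip y (e n) = 0) -> ip (S x) y = 0 by case: (SP x) => _ _; apply.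
have Pself x y n : ip (P x n) y = ip x (P y n).
  rewrite /P ip_suml// ip_sumr//; apply: eq_bigr => k _.
  have cy : conjc (c y k) = ((N (T (e k)))%:C)%C * ip (e k) y.
    by rewrite [ip (e k) y](ipC hip) /c rmorphM; congr (_ * _); exact: conjc_real.
  by rewrite ipZl// ipZr// cy /c mulrAC.
(* The truncations are symmetric by [Pself]; conjugation brings the limit of [P y n] into the first
   argument. *)
have Sself : is_adjoint ip S S.
  move=> x y; rewrite [RHS](ipC hip) -[LHS]conjcK; congr (conjc _).
  apply: complex_eq_eps => eps e0.
  have e2 : 0 < eps / 2 by rewrite divr_gt0.
  have /filter_ex[n [h1 h2]] : \forall n \near \oo,
     nc (ip (P x n) y - ip (S x) y) < eps / 2 /\ nc (ip (P y n) x - ip (S y) x) < eps / 2.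
    near=> n; split; near: n; [exact: (ip_cvg_bound hip y (Scv x) e2)|].
    exact: (ip_cvg_bound hip x (Scv y) e2).
  have -> : conjc (ip (S x) y) - ip (S y) x =
      conjc (ip (S x) y - ip (P x n) y) + (ip (P y n) x - ip (S y) x).
    by rewrite Pself rmorphB /= -[conjc (ip x _)](ipC hip); ring.
  apply: le_lt_trans (le_normcD _ _) _; rewrite nc_conj nc_sub [eps]splitr; exact: ltrD.
exists S; split => //; split => //.
- move=> a x y; apply/eqP; rewrite -subr_eq0; apply/eqP; apply: coef_separation.
    by move=> n; rewrite ipBl// (ip_lin hip) !Se /c (ip_lin hip) mulrDr mulrCA subrr.
  by move=> z ze; rewrite ipBl// (ip_lin hip) !Sy// mulr0 addr0 subrr.
- move=> x; split.
    have := Sself x x; rewrite [RHS](ipC hip); case: (ip _ _) => a b /= [] /eqP.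
    by rewrite -subr_eq0 opprK -mulr2n mulrn_eq0 => /eqP.
  apply: (Re_ip_lim_ge0 hip (Scv x)) => n; rewrite /P ip_suml// raddf_sum sumr_ge0// => k _.
  rewrite ipZl// /c -mulrA [ip (e k) x](ipC hip) mulc_conj -rmorphM /=.
  by rewrite mulr_ge0 ?hnorm_ge0 ?sqr_ge0.
- move=> x; apply/eqP; rewrite -subr_eq0; apply/eqP; apply: coef_separation.
    move=> n; rewrite ipBl// Se /c Se /c (gram_selfadjoint hip adj) Ae ipZr// conjc_real.
    by rewrite mulrA -rmorphM -expr2 subrr.
  move=> y ye; rewrite ipBl// Sy// (gram_selfadjoint hip adj) (kerT ye).
  by rewrite (op_zero (adjoint_linear hip adj)) ip0r// subrr.
Unshelve. all: by end_near. Qed.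

(** The singular values are the positive [N (T (e n))], whose [p]-th powers are controlled by the
    hypothesis on lists of the [e n]. *)
Lemma schatten_of_eigensystem (p C : R) : 0 < p ->
  (forall s : seq H, uniq s -> orthonormal_seq ip s -> \sum_(x <- s) N (T x) `^ p <= C) ->
  schatten ip p T.
Proof.
move=> p0 hC; split=> //.
have [S [sqS Se Sy]] := exists_sqrt.
have sumC (s : seq nat) : uniq s -> {in s, forall n, D n} ->
    \sum_(n <- s) N (T (e n)) `^ p <= C.
  move=> us sD; rewrite -(big_map e xpredT (fun x => N (T x) `^ p)).
  have einj : {in s &, injective e}.
    move=> m n /sD Dm /sD Dn emn; apply/eqP/negPn/negP => nmn.
    have := oe m n; rewrite (negbTE nmn) -emn oe eqxx Dm => /eqP.
    by rewrite oner_eq0.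
  apply: hC; first by rewrite map_inj_in_uniq.
  move=> _ _ /mapP[m ms ->] /mapP[n ns ->]; rewrite oe (sD _ ms) andbT.
  by rewrite (inj_in_eq einj).
have sumN n : \sum_(0 <= k < n) N (T (e k)) `^ p <= C.
  apply: le_trans (sumC [seq k <- index_iota 0 n | D k] _ _).
  - rewrite big_filter [leRHS]big_mkcond; apply: ler_sum => k _.
    case: ifPn => // /(ortho_out hip oe) ->.
    by rewrite op_zero// hnorm0// powR0// gt_eqF.
  - by rewrite filter_uniq// iota_uniq.
  - by move=> k; rewrite mem_filter => /andP[].
exists Ts, S, (fun n => N (T (e n))), e; split => //.
- split.
  + move=> n _; apply/eqP; rewrite -subr_eq0; apply/eqP; apply: coef_separation.
      by move=> m; rewrite ipBl// Se ipZl// oe; case: eqP => [->|_]; rewrite ?subrr//= !mulr0 subrr.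
    by move=> y ye; rewrite ipBl// Sy// ipZl// (ipC hip) ye conjc0 mulr0 subrr.
  + by move=> n m; rewrite -!Dlam => Dn _; rewrite oe Dn andbT; case: eqP.
  + move=> mu x mu0 Sx.
    have mup : 0 < mu `^ p by rewrite powR_gt0.
    (* The [p]-th powers are summable, hence tend to 0, so the value [mu] is taken only below
       [m]. *)
    have [m _ mP] : \forall n \near \oo, N (T (e n)) != mu.
      have : cvgn (series (fun n => N (T (e n)) `^ p)).
        apply: nondecreasing_is_cvgn; last by exists C => _ [n _ <-]; exact: sumN.
        by apply: nondecreasing_series => n _ _; rewrite powR_ge0.
      move=> /cvg_series_cvg_0/cvgrPdist_lt/(_ _ mup); apply: filterS => n.
      rewrite sub0r normrN ger0_norm ?powR_ge0//; apply: contraTneq => ->.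
      by rewrite ltxx.
    exists m.
    (* Comparing coefficients in [S x = mu x] leaves only indices with eigenvalue [mu]. *)
    have xe n : ip x (e n) = if N (T (e n)) == mu then ip x (e n) else 0.
      case: ifPn => // nmu; have := Se x n; rewrite Sx ipZl// => /eqP.
      rewrite -subr_eq0 -mulrBl mulf_eq0 => /orP[|/eqP//].
      rewrite -rmorphB /= => /eqP/(congr1 (@complex.Re R)) /= /eqP.
      by rewrite subr_eq0 eq_sym (negbTE nmu).
    pose y := x - \sum_(0 <= n < m) ip x (e n) *: e n.
    have ye n : ip y (e n) = 0.
      rewrite /y ipBl// (ip_comb hip oe) ?iota_uniq// mem_index_iota /=.
      have [nm|mn] := ltnP n m.
        have [Dn|/(ortho_out hip oe) ->] := boolP (D n); first by rewrite subrr.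
        by rewrite ip0r// subrr.
      by rewrite xe (negbTE (mP n mn)) subrr.
    (* The range of [S], which contains [mu x], is orthogonal to [y]. *)
    have xy : ip x y = 0.
      have := Sy x y ye; rewrite Sx ipZl// => /eqP; rewrite mulf_eq0.
      by move=> /orP[/eqP/(congr1 (@complex.Re R)) /= mu00|/eqP//]; move: mu0; rewrite mu00 ltxx.
    have y0 : y = 0.
      apply: (ip_self_eq0 hip); rewrite {1}/y ipBl// xy ip_suml// big1 ?subr0// => n _.
      by rewrite ipZl// [ip (e n) y](ipC hip) ye conjc0 mulr0.
    move: y0 => /eqP; rewrite subr_eq0 => /eqP xE.
    rewrite {1}xE big_mkord [RHS]big_mkcond; apply: eq_bigr => n _.
    by rewrite xe; case: ifP => // _; rewrite scale0r.
- apply: (@le_lt_trans _ _ C%:E); last exact: ltry.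
  by apply: esum_le_seq => s us sD; apply: sumC => // n /sD; rewrite Dlam.
Qed.

End SquareRoot.
End Spectral.

(** * From basis bounds to Schatten class, and the equivalence *)

Lemma basis_bound_schatten (R : realType) (H : lmodType R[i]) (ip : H -> H -> R[i])
  (hH : separable_hilbert ip) (p C : R) (T : H -> H) : 0 < p -> bounded_linear ip T ->
  (forall (I : countType) (e : I -> H), orthonormal_basis ip e ->
     (\esum_(i in [set: I]) ((hnorm ip (T (e i))) `^ p)%R%:E <= C%:E)%E) ->
  schatten ip p T.
Proof.
move=> p0 /bounded_linear_ge0[linT [M M0 bdT]] /(basis_bound_finite hH) hC.
have cT : compact_op ip T.
  apply: (small_complement_compact hH linT) => eps.
  exact: (small_complement hH linT (ltW p0) hC).
have [Ts adj] := exists_adjoint hH linT M0 bdT.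
have [D [e [oe Ae Dlam kerT]]] := exists_eigensystem hH linT M0 bdT adj cT.
exact: (schatten_of_eigensystem hH linT M0 bdT adj cT oe Ae Dlam kerT p0 hC).
Qed.

Theorem theorem4 (R : realType) (H : lmodType R[i]) (ip : H -> H -> R[i])
  (hH : separable_hilbert ip) (p : R) (hp2 : 2 <= p) (T : H -> H)
  (hT : bounded_linear ip T) :
  [<-> schatten ip p T;
       exists C : R, 0 < C /\ forall (I : countType) (e : I -> H),
         orthonormal_basis ip e ->
         (\esum_(i in [set: I]) ((hnorm ip (T (e i))) `^ p)%R%:E <= C%:E)%E;
       exists C : R, 0 < C /\ forall (I : countType) (f : I -> H),
         is_frame ip f -> upper_frame_bound ip f <= 1 ->
         (\esum_(i in [set: I]) ((hnorm ip (T (f i))) `^ p)%R%:E <= C%:E)%E].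
Proof.
have p0 : 0 < p by lra.
tfae.
- move=> /(schatten_bessel_bound hH hp2 hT)[C [C0 hC]]; exists C; split=> // I e [oe _].
  exact: hC (orthonormal_bessel hH oe).
(* The passage from bases to frames goes through (i), whose estimate covers all Bessel families. *)
- move=> [C1 [_ /(basis_bound_schatten hH p0 hT)]].
  move=> /(schatten_bessel_bound hH hp2 hT)[C [C0 hC]]; exists C; split=> // I f ff f1.
  exact: hC (frame_bessel ff f1).
- move=> [C [_ hC]]; apply: (basis_bound_schatten (C := C) hH p0 hT) => I e be.
  by have [fe fe1] := basis_frame hH be; apply: hC.
Qed.
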